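(* Let $q$ be a prime power, $n\ge 1$, $m\ge 1$, let $k$ be a finite field of cardinality $q^n$, let $R=k[X_0,\ldots,X_{m-1}]$, and let $\mathcal{F}\subset R$ be a finite subset generating the ideal $I$. Let $Z(\mathcal{F})\subseteq\overline{k}^m$ be the set of zeros of $\mathcal{F}$ over the algebraic closure $\overline{k}$. Assume: \begin{itemize} \item $I$ is zero-dimensional, and $s$ is an integer with $|Z(\mathcal{F})|\le s$; \item $I$ is radical; \item there is a coordinate $t$ such that the projection map $Z(\mathcal{F})\to\overline{k}$ to coordinate $t$ is injective. \end{itemize} Let $k'$ be the subfield of $k$ of cardinality $q$, and let $\mathcal{F}'_f$ be the Weil descent system of $\mathcal{F}$ to $k'$ using some basis of $k/k'$, together with the field equations. Then $$d_{\mathcal{F}'_f}\le\max\bigl(\tau(\max(d_{\mathcal{F}},\deg(\mathcal{F}),(m+1)s,1),q,m),\ m\cdot\tau(2s,q,1),\ q\bigr).$$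
   Context: Degree means total degree, and $\deg(\mathcal{F})=\max\{\deg(f):f\in\mathcal{F}\}$. The function $\tau$: for $r\in\mathbf{Z}_{\ge0}$ and $c,t\in\mathbf{Z}_{\ge1}$, $\tau(r,c,t)=\max\left(\left\lfloor 2t(c-1)\left(\log_c\left(\frac{r}{2t}\right)+1\right)\right\rfloor,0\right)$, where $\log_c 0=-\infty$, so $\tau(0,c,t)=0$. Last fall degree: let $K$ be a field, $P$ a polynomial ring over $K$ in finitely many variables, $\mathcal{H}\subset P$ a finite subset, and $J$ the ideal generated by $\mathcal{H}$. For $i\in\mathbf{Z}_{\ge0}$ let $V_{\mathcal{H},i}$ be the smallest $K$-vector space such that (1) $\{f\in\mathcal{H}:\deg(f)\le i\}\subseteq V_{\mathcal{H},i}$; (2) if $g\in V_{\mathcal{H},i}$ and $h\in P$ with $\deg(hg)\le i$, then $hg\in V_{\mathcal{H},i}$. Set $V_{\mathcal{H},\infty}=J$. The last fall degree $d_{\mathcal{H}}$ is the minimal $d\in\mathbf{Z}_{\ge0}\sqcup\{\infty\}$ such that for all $f\in J$ one has $f\in V_{\mathcal{H},\max(d,\deg(f))}$. Weil descent system: let $\alpha_0,\ldots,\alpha_{n-1}$ be a basis of $k/k'$. For $f\in\mathcal{F}$ define $[f]_j\in k'[X_{il}:i=0,\ldots,m-1,\ l=0,\ldots,n-1]$, $j=0,\ldots,n-1$, by $$f\Bigl(\sum_{l=0}^{n-1}\alpha_lX_{0l},\ldots,\sum_{l=0}^{n-1}\alpha_lX_{m-1\,l}\Bigr)\equiv\sum_{j=0}^{n-1}[f]_j\alpha_j\pmod{X_{il}^q-X_{il},\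 i=0,\ldots,m-1,\ l=0,\ldots,n-1},$$ where $[f]_j$ is chosen of minimal degree (so its degree in each variable $X_{il}$ is at most $q-1$). Set $\mathcal{F}'=\{[f]_j:f\in\mathcal{F},\ j=0,\ldots,n-1\}$ and $\mathcal{F}'_f=\mathcal{F}'\cup\{X_{ij}^q-X_{ij}:i=0,\ldots,m-1,\ j=0,\ldots,n-1\}$. The last fall degree $d_{\mathcal{F}'_f}$ is taken over $k'$ in the polynomial ring $k'[X_{ij}]$; $d_{\mathcal{F}}$ is taken over $k$ in $R$. *)

(* Defs.v *)
From Stdlib Require Reals.
From HB Require Import structures.
From mathcomp Require Import all_boot all_order all_algebra all_field.
From mathcomp Require Import mpoly.

Set Implicit Arguments.
Unset Strict Implicit.
Unset Printing Implicit Defensive.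

Import GRing.Theory.

Module Tau.
Import Reals.
Local Open Scope R_scope.

(* The case r = 0 encodes log_c 0 = -oo (Stdlib's ln 0 is a junk value);
   Z.to_nat truncates negative integers to 0, i.e. it is max(_, 0). *)
Definition tau (r c t : nat) : nat :=
  match r with
  | O => O
  | S _ =>
    Z.to_nat (Int_part
      (2 * INR t * (INR c - 1) * (Rlog (INR c) (INR r / (2 * INR t)) + 1)))
  end.
End Tau.

Notation tau := Tau.tau.

Local Open Scope ring_scope.

(* Natural numbers extended by infinity: [None] is oo. *)
Definition enat := option nat.

Definition ele (a b : enat) : Prop :=
  match a, b with
  | _, None => True
  | None, Some _ => False
  | Some x, Some y => (x <= y)%N
  end.

Definition emax (a b : enat) : enat :=
  match a, b with
  | Some x, Some y => Some (maxn x y)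
  | _, _ => None
  end.

(* tau is nondecreasing and unbounded in r for c >= 2, whence tau(oo) = oo. *)
Definition etau (r : enat) (c t : nat) : enat := omap (fun x => tau x c t) r.

Section Ideals.
Variable A : comNzRingType.

Definition in_ideal (H : seq A) (f : A) : Prop :=
  exists c : 'I_(size H) -> A, f = \sum_(i < size H) c i * H`_i.

Definition radical_ideal (H : seq A) : Prop :=
  forall (f : A) (e : nat), in_ideal H (f ^+ e) -> in_ideal H f.

End Ideals.

Section PolynomialSystems.
Variables (K : fieldType) (v : nat).
Local Notation P := {mpoly K[v]}.

(* Total degree; msize is one more than the degree, and mdegree 0 = 0. *)
Definition mdegree (f : P) : nat := (msize f).-1.

Definition sys_degree (H : seq P) : nat := \max_(f <- H) mdegree f.

(* P/J is nonzero and of finite dimension over K.  The first conjunct matters: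
   the unit ideal has empty zero set and is not zero-dimensional. *)
Definition zero_dimensional (H : seq P) : Prop :=
  ~ in_ideal H 1 /\
  exists B : seq P, forall f : P, exists c : 'I_(size B) -> K,
    in_ideal H (f - \sum_(i < size B) c i *: B`_i).

Inductive fall_space (H : seq P) (i : nat) : P -> Prop :=
| fall_gen f of f \in H & (mdegree f <= i)%N : fall_space H i f
| fall_zero : fall_space H i 0
| fall_add f g of fall_space H i f & fall_space H i g : fall_space H i (f + g)
| fall_scale (a : K) f of fall_space H i f : fall_space H i (a *: f)
| fall_mul g h of fall_space H i g & (mdegree (h * g) <= i)%N :
    fall_space H i (h * g).

Definition fall_space_ext (H : seq P) (d : enat) (f : P) : Prop :=
  match d with
  | Some i => fall_space H i f
  | None => in_ideal H f
  end.

Definition fall_bound (H : seq P) (d : enat) : Prop :=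
  forall f : P, in_ideal H f ->
    fall_space_ext H (emax d (Some (mdegree f))) f.

Definition last_fall_degree (H : seq P) (d : enat) : Prop :=
  fall_bound H d /\ forall d' : enat, fall_bound H d' -> ele d d'.

End PolynomialSystems.

Definition zero_locus (k : fieldType) (K : fieldType) (phi : {rmorphism k -> K})
    (m : nat) (F : seq {mpoly k[m]}) (z : m.-tuple K) : Prop :=
  forall f, f \in F -> (map_mpoly phi f).@[tnth z] = 0.

Section WeilDescent.
Variables (k' k : fieldType) (iota : {rmorphism k' -> k}) (q m n : nat).

Definition is_basis (alpha : 'I_n -> k) : Prop :=
  forall x : k, exists! c : {ffun 'I_n -> k'},
    x = \sum_(l < n) iota (c l) * alpha l.

(* The variable X_{il}: mxvec_index is a bijection from 'I_m * 'I_n onto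
   'I_(m * n). *)
Definition Xvar (A : nzRingType) (i : 'I_m) (l : 'I_n) : {mpoly A[m * n]} :=
  'X_(mxvec_index i l).

Definition field_eqs (A : nzRingType) : seq {mpoly A[m * n]} :=
  [seq Xvar A i l ^+ q - Xvar A i l | i <- enum 'I_m, l <- enum 'I_n].

Definition weil_subst (alpha : 'I_n -> k) (f : {mpoly k[m]}) :
    {mpoly k[m * n]} :=
  f \mPo [tuple \sum_(l < n) alpha l *: Xvar k i l | i < m].

(* g j is [f]_j.  The second conjunct picks the reduced representative, the
   unique one of degree at most q - 1 in each variable; its degree in each
   variable and its total degree are minimal among all representatives. *)
Definition is_weil_descent (alpha : 'I_n -> k) (f : {mpoly k[m]})
    (g : 'I_n -> {mpoly k'[m * n]}) : Prop :=
  in_ideal (field_eqs k)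
    (weil_subst alpha f - \sum_(j < n) alpha j *: map_mpoly iota (g j)) /\
  forall j (mu : 'X_{1..m * n}), mu \in msupp (g j) ->
    forall x : 'I_(m * n), (mu x <= q.-1)%N.

Definition weil_system (F : seq {mpoly k[m]})
    (W : {mpoly k[m]} -> 'I_n -> {mpoly k'[m * n]}) : seq {mpoly k'[m * n]} :=
  [seq W f j | f <- F, j <- enum 'I_n] ++ field_eqs k'.

End WeilDescent.

(* Main.v *)
Require Import Defs.
From Stdlib Require Reals Lra.
From HB Require Import structures.
From mathcomp Require Import all_boot all_order all_algebra all_field.
From mathcomp Require Import mpoly zify.

(** Work in S = k[X_il] with the linear forms L_ij = sum_l alpha_l^(q^j) X_il,
    whose value at a k'-rational point is z_i^(q^j), where z is the corresponding
    point of k^m.  Modulo the field equations an element of S is determined, with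
    control of degrees, by its values at the k'-rational points, so a monomial
    X^e of R can be replaced by a product of forms L_ij whose degree is the sum
    of the base-q digits of the exponents; multiplying by one variable at a time,
    this transports V_{F,r} into V_D, where D is the claimed bound.
    By the shape lemma I contains some f(X_t), of degree at most s, and
    polynomials X_i - p_i(X_t).  Arithmetic modulo f stays within degree D,
    hence each L_ij, and so each X_il, is congruent to the lift of a polynomial
    in X_t of degree less than deg f.  Therefore every h in S is congruent to
    such a lift of some c modulo V_{max(D, deg h)}; if h lies in the ideal then
    c vanishes at the roots of f in k, so c is in the ideal (f, T^(q^n) - T)
    and its lift is in V_D.  Finally one descends from k to k'. *)

Set Implicit Arguments.
Unset Strict Implicit.
Unset Printing Implicit Defensive.

Import GRing.Theory Num.Theory.

Local Open Scope ring_scope.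

(** * Lower bounds on [tau] from inequalities between natural numbers *)

Module TauBound.
Import Reals Lra.
Local Open Scope R_scope.

(* [expn] is explicit below because Reals rebinds [^] on nat to [Nat.pow]. *)
Lemma INR_expn a b : INR (expn a b) = pow (INR a) b.
Proof. by elim: b => [|b IH] //=; rewrite expnS mult_INR IH. Qed.

(** With [e = 2t(c-1)], taking logarithms to base [c] turns the last hypothesis into
    [N <= e (log_c (r / 2t) + 1)], and [tau] is the floor of the right-hand side. Every later
    comparison with [tau] goes through this criterion, so real numbers occur only here. *)
Lemma leq_tau (N r c t : nat) : (0 < r)%nat -> (1 < c)%nat -> (0 < t)%nat ->
  (expn c N * expn (2 * t) (2 * t * c.-1) <= expn (r * c) (2 * t * c.-1))%nat ->
  (N <= tau r c t)%nat.
Proof.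
case: r => // r0 _; set r := r0.+1 => c1 t0.
set e := (2 * t * c.-1)%nat => H.
rewrite /Tau.tau -/r.
set E := (X in Int_part X).
suff : INR N <= E.
  move=> HE; have [_ h2] := base_Int_part E.
  have : INR N < IZR (Int_part E) + 1 by lra.
  rewrite INR_IZR_INZ -plus_IZR => /lt_IZR /=; lia.
have hc : 1 < INR c by apply: lt_1_INR; lia.
have lc : 0 < ln (INR c) by rewrite -ln_1; apply: ln_increasing; lra.
have ht : 0 < INR t by apply: lt_0_INR; lia.
have hr : 0 < INR r by apply: lt_0_INR; lia.
have HR : INR c ^ N * (2 * INR t) ^ e <= (INR r * INR c) ^ e.
  have := le_INR _ _ (leP H).
  by rewrite mult_INR !INR_expn !mult_INR.
have h2t : 0 < 2 * INR t by lra.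
have K : INR N * ln (INR c) + INR e * ln (2 * INR t) <=
    INR e * (ln (INR r) + ln (INR c)).
  rewrite -(ln_mult (INR r)); try lra.
  rewrite -!ln_pow; try nra.
  rewrite -ln_mult; try (apply: pow_lt; lra).
  case: (Rle_lt_or_eq_dec _ _ HR) => [H1|->]; last by right.
  by left; apply: ln_increasing => //; apply: Rmult_lt_0_compat; apply: pow_lt; lra.
have Ee : INR e = 2 * INR t * (INR c - 1).
  rewrite /e !mult_INR; congr (_ * _).
  have -> : c = S c.-1 by lia.
  by rewrite S_INR /=; lra.
have -> : E = 2 * INR t * (INR c - 1) *
    (ln (INR r / (2 * INR t)) + ln (INR c)) / ln (INR c).
  by rewrite /E /Rlog; field; lra.
rewrite -Ee /Rdiv ln_mult ?ln_Rinv //; last exact: Rinv_0_lt_compat.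
apply: (Rmult_le_reg_r (ln (INR c))) => //; rewrite Rmult_assoc Rinv_l; lra.
Qed.

End TauBound.
Import TauBound.

(** * Elementary inequalities *)

Lemma leq_expl a b e : (a <= b)%N -> (a ^ e <= b ^ e)%N.
Proof. by case: e => // e; rewrite leq_exp2r. Qed.

(** Bernoulli's inequality [(1 + 1/a)^k >= 1 + k/a], cleared of denominators. *)
Lemma expn_succ_ge a k : (a ^ k * (a + k) <= a.+1 ^ k * a)%N.
Proof. by elim: k => [|k IH]; rewrite ?addn0 // !expnS; nia. Qed.

(** The inequality of arithmetic and geometric means, cleared of denominators; it is transferred
    from the integers. *)
Lemma AGM_nat n (E : 'I_n -> nat) :
  (n ^ n * \prod_(i < n) E i <= (\sum_(i < n) E i) ^ n)%N.
Proof.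
have h0 : {in xpredT, forall i : 'I_n, 0 <= ((E i)%:R : int) *+ #|xpredT : pred 'I_n|}.
  by move=> i _; rewrite mulrn_wge0 ?ler0n.
have [H _] := leif_AGM_scaled h0.
rewrite card_ord in H; move: H; under eq_bigr do rewrite -mulrnA.
rewrite -natr_prod -natr_sum -natrX ler_nat; apply: leq_trans.
by rewrite big_split /= prod_nat_const card_ord mulnC.
Qed.

(** * Base-[q] digit sums and their comparison with [tau] *)

Fixpoint digit_sum (q fuel e : nat) : nat :=
  if fuel is f.+1 then (e %% q + digit_sum q f (e %/ q))%N else 0%N.

(** For [q > 1] the quotients decrease strictly, so [e] steps exhaust the digits of [e]. The weight
    bounds the degree of the product of linear forms, [Lpow] below, that takes [e]-th powers as
    values. *)
Definition weight (q e : nat) : nat := digit_sum q e e.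

Section Weight.
Variable q : nat.
Hypothesis q1 : (1 < q)%N.

Lemma digit_sum0 f : digit_sum q f 0 = 0%N.
Proof. by elim: f => //= f IH; rewrite mod0n div0n IH. Qed.

Lemma digit_sum_fuel f e : (e <= f)%N -> digit_sum q f e = weight q e.
Proof.
have aux g h a : (a <= g)%N -> (a <= h)%N -> digit_sum q g a = digit_sum q h a.
  elim: g h a => [|g IH] [|h] [|a] //= ag ah.
  - by rewrite mod0n div0n digit_sum0.
  - by rewrite mod0n div0n digit_sum0.
  - by rewrite mod0n div0n !digit_sum0.
  - by congr (_ + _)%N; apply: IH; have := ltn_Pdiv q1 (ltn0Sn a); lia.
by move=> ef; apply: aux.
Qed.

(** Either the last digit grows by one, or it drops from [q - 1] to [0] and the carry adds at most
    one to the remaining digits by induction. *)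
Lemma digit_sum_succ f a : (digit_sum q f a.+1 <= (digit_sum q f a).+1)%N.
Proof.
elim: f a => //= f IH a.
have Ha := divn_eq a q; have lt := @ltn_pmod a q (ltnW q1).
have [hd|hd] := ltnP (a %% q).+1 q.
  have -> : (a.+1 %/ q = a %/ q)%N.
    by rewrite {1}Ha -addnS divnMDl 1?ltnW // [X in (_ + X)%N]divn_small ?addn0.
  have -> : (a.+1 %% q = (a %% q).+1)%N.
    by rewrite {1}Ha -addnS modnMDl modn_small.
  by [].
have E : a.+1 = ((a %/ q).+1 * q)%N by rewrite mulSn {1}Ha; lia.
have -> : (a.+1 %/ q = (a %/ q).+1)%N by rewrite E mulnK 1?ltnW.
have -> : (a.+1 %% q = 0)%N by rewrite E modnMl.
by have := IH (a %/ q)%N; lia.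
Qed.

Lemma weight_succ a : (weight q a.+1 <= (weight q a).+1)%N.
Proof. by rewrite /weight (leq_trans (digit_sum_succ _ _)) ?digit_sum_fuel. Qed.

Lemma digit_sum_le f e : (digit_sum q f e <= e)%N.
Proof.
elim: f e => //= f IH e; rewrite {3}(divn_eq e q) addnC leq_add2r.
by apply: leq_trans (IH _) _; rewrite leq_pmulr // ltnW.
Qed.

Lemma weight_le e : (weight q e <= e)%N.
Proof. exact: digit_sum_le. Qed.

(** The AM-GM inequality for [q - 1] numbers, of which [d] equal [q] and the others [1]: their sum
    is [(q - 1)(d + 1)]. *)
Lemma expn_digit_le d : (d <= q.-1)%N -> (q ^ d <= d.+1 ^ q.-1)%N.
Proof.
move=> dq; pose P : pred 'I_q.-1 := fun i => (i < d)%N.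
have cP : #|P| = d.
  rewrite -sum1_card (eq_bigl (fun i : 'I_q.-1 => (i < d)%N)) //.
  rewrite -(big_ord_widen _ (fun=> 1%N)) // sum1_card; exact: card_ord.
have := AGM_nat (fun i => if P i then q else 1%N).
rewrite -big_mkcond prod_nat_const cP (bigID P) /=.
rewrite (eq_bigr (fun=> q)); last by move=> i ->.
rewrite (eq_bigr (fun=> 1%N) (P := fun i => ~~ _)); last by move=> i /negPf->.
rewrite !sum_nat_const cP.
have -> : #|[pred i | ~~ P i]| = (q.-1 - d)%N.
  by apply/eqP; rewrite -(eqn_add2l d) -{1}cP (cardC P) card_ord subnKC.
rewrite (_ : (_ + _ = q.-1 * d.+1)%N); last by nia.
by rewrite expnMn leq_pmul2l // expn_gt0; apply/orP; left; lia.
Qed.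

(** Induction on the digits: if [e = a q + d] with [d < q], then [(d + 1)(a + 1) <= e + 1]. In
    logarithmic form, the digit sum is at most [(q - 1) log_q (e + 1)]. *)
Lemma expn_digit_sum f e : (q ^ digit_sum q f e <= e.+1 ^ q.-1)%N.
Proof.
elim: f e => [|f IH] e /=; first by rewrite expn_gt0.
have lt := @ltn_pmod e q (ltnW q1).
rewrite expnD (leq_trans (leq_mul (@expn_digit_le (e %% q) _) (IH _))) //; first lia.
rewrite -expnMn leq_exp2r; last lia.
by rewrite {3}(divn_eq e q); move: (e %% q)%N (e %/ q)%N lt => d a; nia.
Qed.

Lemma expn_weight e : (q ^ weight q e <= e.+1 ^ q.-1)%N.
Proof. exact: expn_digit_sum. Qed.

Definition mon_weight m (e : 'X_{1..m}) : nat := (\sum_(i < m) weight q (e i))%N.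

Lemma mon_weight_le m (e : 'X_{1..m}) : (mon_weight e <= mdeg e)%N.
Proof. by rewrite mdegE leq_sum // => i _; exact: weight_le. Qed.

Lemma mon_weight_addU m (e : 'X_{1..m}) i :
  (mon_weight (U_(i) + e)%MM <= (mon_weight e).+1)%N.
Proof.
rewrite /mon_weight (bigD1 i) //= [in X in (_ <= X.+1)%N](bigD1 i) //=.
rewrite mnmDE mnm1E eqxx add1n -addSn leq_add ?weight_succ //.
by apply: eq_leq; apply: eq_bigr => j ji; rewrite mnmDE mnm1E eq_sym (negPf ji).
Qed.

(** The bounds for the single exponents are multiplied, and AM-GM is applied to the numbers
    [e i + 1], whose sum is [mdeg e + m]. *)
Lemma expn_mon_weight m (e : 'X_{1..m}) :
  (q ^ mon_weight e * m ^ (m * q.-1) <= (mdeg e + m) ^ (m * q.-1))%N.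
Proof.
have /leq_trans h : (q ^ mon_weight e * m ^ (m * q.-1) <=
    (m ^ m * \prod_(i < m) (e i).+1) ^ q.-1)%N.
  rewrite expnMn -expnM mulnC leq_mul // /mon_weight expn_sum.
  rewrite (big_morph (fun x => x ^ q.-1)%N (fun x y => expnMn x y q.-1) (exp1n _)).
  by apply: leq_prod => i _; exact: expn_weight.
apply: h; rewrite expnM; apply: leq_expl.
apply: (leq_trans (AGM_nat _)); apply: leq_expl.
have -> : (mdeg e + m = \sum_(i < m) (e i + 1))%N.
  by rewrite mdegE big_split /= sum1_card card_ord.
by apply: eq_leq; apply: eq_bigr => i _; rewrite addn1.
Qed.

(* For r < 2m the first term can be smaller than the weight (the logarithm may
   even be negative); then the crude bound 2m <= m * tau (2 * s) q 1 is used. *)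
Lemma mon_weight_bound m r s (e : 'X_{1..m}) : (0 < m)%N -> (0 < s)%N ->
  (mdeg e < r)%N -> ((mon_weight e).+1 <= maxn (tau r q m) (m * tau (2 * s) q 1))%N.
Proof.
move=> m0 s0 er; have [rm|rm] := ltnP r (2 * m).
  rewrite leq_max; apply/orP; right.
  have h2 : (2 <= tau (2 * s) q 1)%N.
    apply: leq_tau => //; first lia.
    rewrite !muln1 -mulnA (expnMn 2) mulnC leq_mul //.
    apply: (@leq_trans (q ^ (2 * q.-1)))%N; first by rewrite leq_exp2l; lia.
    by apply: leq_expl; rewrite leq_pmull.
  by have := mon_weight_le e; nia.
rewrite leq_max; apply/orP; left; apply: leq_tau => //; first lia.
(* The factor [2], once raised to the power [q - 1], absorbs the factor [q] that the successor of
   the weight costs. It is available because [(m + 1)^m >= 2 m^m] and, for [r >= 2m],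
   [(m + 1)(r - 1 + m) <= r^2]. *)
have hr : (2 * (m * (r.-1 + m)) ^ m <= r ^ (2 * m))%N.
  have h1 : (2 * m ^ m <= m.+1 ^ m)%N by have := expn_succ_ge m m; nia.
  rewrite expnMn mulnA; apply: (leq_trans (leq_mul h1 (leqnn _))).
  by rewrite -expnMn expnM; apply: leq_expl; nia.
have {}hr : (2 ^ q.-1 * ((m ^ (m * q.-1)) * (r.-1 + m) ^ (m * q.-1)) <=
    r ^ (2 * m * q.-1))%N.
  by rewrite !expnM -!expnMn; apply: leq_expl; rewrite -?expnM.
have hA : (q ^ mon_weight e * m ^ (m * q.-1) <= (r.-1 + m) ^ (m * q.-1))%N.
  by apply: leq_trans (expn_mon_weight e) _; apply: leq_expl; lia.
have hq : (q <= 2 ^ q.-1)%N by have := ltn_expl q.-1 (ltnSn 1); lia.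
have h2 : (2 ^ (2 * m * q.-1) <= q ^ (2 * m * q.-1))%N by exact: leq_expl.
rewrite expnS [in leqRHS]expnMn expnMn (mulnC (2 ^ _)%N) mulnA.
apply: leq_mul => //; apply: leq_trans hr.
rewrite (_ : 2 * m * q.-1 = m * q.-1 + m * q.-1)%N; last by rewrite mul2n -addnn mulnDl.
rewrite expnD mulnA -[in leqLHS](mulnA q) -mulnA; apply: leq_mul => //.
by rewrite mulnC; apply: leq_mul.
Qed.

(** This controls the degree of a product of two lifts of residues modulo a polynomial of degree at
    most [s]: the two weights together are at most [2 (q - 1) log_q s]. *)
Lemma weight_pair_bound s a b : (a < s)%N -> (b < s)%N ->
  (weight q a + weight q b <= tau (2 * s) q 1)%N.
Proof.
move=> a_s b_s; apply: leq_tau => //; first lia.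
rewrite !muln1 -mulnA (expnMn 2) mulnC leq_mul // expnD expnM.
apply: leq_trans (leq_mul (expn_weight a) (expn_weight b)) _.
by rewrite -expnMn; apply: leq_expl; rewrite -mulnn; apply: leq_mul; nia.
Qed.

(** Since [q <= 2^(q-1)], the successor costs no more than doubling [a + 1], and
    [2 (a + 1) <= (s q)^2]. It leaves room for one more linear factor on a lift whose exponents are
    below [2s - 2]. *)
Lemma weight_succ_bound s a : (a < 2 * s - 2)%N ->
  ((weight q a).+1 <= tau (2 * s) q 1)%N.
Proof.
move=> a_s; apply: leq_tau => //; first lia.
rewrite !muln1 -mulnA (expnMn 2) mulnC leq_mul // expnS expnM.
have hq : (q <= 2 ^ q.-1)%N by have := ltn_expl q.-1 (ltnSn 1); lia.
apply: leq_trans (leq_mul hq (expn_weight a)) _.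
by rewrite -expnMn; apply: leq_expl; rewrite -mulnn; apply: leq_mul; nia.
Qed.

End Weight.

(** * Closure properties of ideals *)

Section InIdeal.
Variable A : comNzRingType.
Implicit Types (H : seq A) (f g : A).

Lemma in_ideal0 H : in_ideal H 0.
Proof. by exists (fun=> 0); rewrite big1 // => i _; rewrite mul0r. Qed.

Lemma in_idealD H f g : in_ideal H f -> in_ideal H g -> in_ideal H (f + g).
Proof.
move=> [c ->] [d ->]; exists (fun i => c i + d i).
by rewrite -big_split; apply: eq_bigr => i _; rewrite mulrDl.
Qed.

Lemma in_idealM H f g : in_ideal H g -> in_ideal H (f * g).
Proof.
move=> [c ->]; exists (fun i => f * c i).
by rewrite mulr_sumr; apply: eq_bigr => i _; rewrite mulrA.
Qed.

Lemma in_idealMr H f g : in_ideal H f -> in_ideal H (f * g).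
Proof. by rewrite mulrC; exact: in_idealM. Qed.

Lemma in_idealN H f : in_ideal H f -> in_ideal H (- f).
Proof. by rewrite -mulN1r; exact: in_idealM. Qed.

Lemma in_idealB H f g : in_ideal H f -> in_ideal H g -> in_ideal H (f - g).
Proof. by move=> hf hg; apply: in_idealD => //; exact: in_idealN. Qed.

Lemma in_ideal_mem H f : f \in H -> in_ideal H f.
Proof.
move=> fH; have hi : (index f H < size H)%N by rewrite index_mem.
exists (fun i => (i == Ordinal hi)%:R).
rewrite (bigD1 (Ordinal hi)) //= eqxx mul1r nth_index // big1 ?addr0 //.
by move=> i /negPf->; rewrite mul0r.
Qed.

Lemma in_ideal_sum H (I : Type) (r : seq I) (P : pred I) (F : I -> A) :
  (forall i, P i -> in_ideal H (F i)) -> in_ideal H (\sum_(i <- r | P i) F i).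
Proof.
move=> HF; apply: (big_ind (in_ideal H)) => //; first exact: in_ideal0.
exact: in_idealD.
Qed.

Lemma in_ideal_subset H H' f : (forall g, g \in H -> in_ideal H' g) ->
  in_ideal H f -> in_ideal H' f.
Proof.
move=> HH [c ->]; apply: in_ideal_sum => i _; apply: in_idealM.
exact/HH/mem_nth.
Qed.

Lemma in_ideal_rmorph (B : comNzRingType) (phi : {rmorphism A -> B}) H f :
  (forall g, g \in H -> phi g = 0) -> in_ideal H f -> phi f = 0.
Proof.
move=> HH [c ->]; rewrite rmorph_sum big1 // => i _.
by rewrite rmorphM (HH H`_i) ?mulr0 ?mem_nth.
Qed.

End InIdeal.

(** * Total degree over a field *)

Section Degree.
Variables (K : fieldType) (v : nat).
Implicit Types (f g h : {mpoly K[v]}).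

Lemma mdegree_leE f d : (mdegree f <= d)%N = (msize f <= d.+1)%N.
Proof. by rewrite /mdegree; case: (msize f). Qed.

Lemma mdegree_leP f d :
  reflect (forall e, e \in msupp f -> (mdeg e <= d)%N) (mdegree f <= d)%N.
Proof.
rewrite mdegree_leE; apply: (iffP idP) => [fd e ef|fd].
  by rewrite -ltnS; apply: leq_trans fd; exact: mmeasure_mnm_lt.
by rewrite mmeasureE; apply/bigmax_leqP_seq => e ef _; rewrite ltnS fd.
Qed.

Lemma mdeg_mdegree f e : e \in msupp f -> (mdeg e <= mdegree f)%N.
Proof. by move=> ef; have /mdegree_leP := leqnn (mdegree f); exact. Qed.

Lemma mdegree0 : mdegree (0 : {mpoly K[v]}) = 0%N.
Proof. by rewrite /mdegree mmeasure0. Qed.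

Lemma mdegreeC c : mdegree (c%:MP_[v] : {mpoly K[v]}) = 0%N.
Proof. by rewrite /mdegree msizeC; case: (c == 0). Qed.

Lemma mdegreeX e : mdegree ('X_[e] : {mpoly K[v]}) = mdeg e.
Proof. by rewrite /mdegree msizeX. Qed.

Lemma mdegreeD f g d : (mdegree f <= d)%N -> (mdegree g <= d)%N ->
  (mdegree (f + g) <= d)%N.
Proof.
rewrite !mdegree_leE => fd gd; apply: leq_trans (msizeD_le _ _) _.
by rewrite geq_max fd.
Qed.

Lemma mdegreeN f : mdegree (- f) = mdegree f.
Proof. by rewrite /mdegree msizeN. Qed.

Lemma mdegreeB f g d : (mdegree f <= d)%N -> (mdegree g <= d)%N ->
  (mdegree (f - g) <= d)%N.
Proof. by move=> fd gd; rewrite mdegreeD ?mdegreeN. Qed.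

Lemma mdegreeZ c f : (mdegree (c *: f) <= mdegree f)%N.
Proof. by rewrite mdegree_leE (leq_trans (msizeZ_le _ _)) // -mdegree_leE. Qed.

Lemma mdegree_sum (I : Type) (r : seq I) (P : pred I) (F : I -> {mpoly K[v]}) d :
  (forall i, P i -> (mdegree (F i) <= d)%N) ->
  (mdegree (\sum_(i <- r | P i) F i) <= d)%N.
Proof.
move=> H; apply: (big_ind (fun f => mdegree f <= d)%N) => //.
  by rewrite mdegree0.
by move=> f g; exact: mdegreeD.
Qed.

Lemma mdegreeM f g : f != 0 -> g != 0 ->
  mdegree (f * g) = (mdegree f + mdegree g)%N.
Proof.
move=> f0 g0; rewrite /mdegree msizeM //.
by rewrite (mpolySpred _ f0) (mpolySpred _ g0) addnS.
Qed.

Lemma mdegreeM_le f g : (mdegree (f * g) <= mdegree f + mdegree g)%N.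
Proof.
have [->|f0] := eqVneq f 0; first by rewrite mul0r mdegree0.
have [->|g0] := eqVneq g 0; first by rewrite mulr0 mdegree0.
by rewrite mdegreeM.
Qed.

Lemma mdegree_prod (I : Type) (r : seq I) (P : pred I) (F : I -> {mpoly K[v]})
    (w : I -> nat) :
  (forall i, P i -> (mdegree (F i) <= w i)%N) ->
  (mdegree (\prod_(i <- r | P i) F i) <= \sum_(i <- r | P i) w i)%N.
Proof.
move=> H; apply: (big_ind2 (fun f d => mdegree f <= d)%N) => //.
  by rewrite mdegreeC.
by move=> f d g e fd ge; apply: leq_trans (mdegreeM_le _ _) (leq_add fd ge).
Qed.

Lemma mdegree_exp f n : (mdegree (f ^+ n) <= mdegree f * n)%N.
Proof.
elim: n => [|n IH]; first by rewrite expr0 mdegreeC.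
by rewrite exprS mulnS (leq_trans (mdegreeM_le _ _)) ?leq_add2l.
Qed.

End Degree.

Lemma mnm_neq0_split n (e : 'X_{1..n}) :
  e != 0%MM -> exists i, e = (U_(i) + (e - U_(i)))%MM.
Proof.
rewrite -mdeg_eq0 mdegE sum_nat_eq0 negb_forall => /existsP[i /= ei].
by exists i; rewrite addmC submK // lep1mP.
Qed.

(** * Fall spaces, and induction by multiplication with single variables *)

Section FallSpace.
Variables (K : fieldType) (v : nat).
Implicit Types (f g h : {mpoly K[v]}) (H : seq {mpoly K[v]}).

Lemma fall_degree H d f : fall_space H d f -> (mdegree f <= d)%N.
Proof.
elim=> {f} // [|f g _ hf _ hg|a f _ hf]; first by rewrite mdegree0.
  exact: mdegreeD.
exact: leq_trans (mdegreeZ _ _) hf.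
Qed.

Lemma fallN H d f : fall_space H d f -> fall_space H d (- f).
Proof. by rewrite -scaleN1r; exact: fall_scale. Qed.

Lemma fallB H d f g : fall_space H d f -> fall_space H d g ->
  fall_space H d (f - g).
Proof. by move=> hf hg; apply: fall_add => //; exact: fallN. Qed.

Lemma fall_sum H d (I : Type) (r : seq I) (P : pred I) F :
  (forall i, P i -> fall_space H d (F i)) ->
  fall_space H d (\sum_(i <- r | P i) F i).
Proof.
move=> HF; apply: (big_ind (fall_space H d)) => //; first exact: fall_zero.
exact: fall_add.
Qed.

Lemma fall_leq H H' d d' f : {subset H <= H'} -> (d <= d')%N ->
  fall_space H d f -> fall_space H' d' f.
Proof.
move=> HH dd; elim=> {f} [f fH fd||f g _ hf _ hg|a f _ hf|g h _ hg ghd].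
- by apply: fall_gen; [exact: HH | exact: leq_trans dd].
- exact: fall_zero.
- exact: fall_add.
- exact: fall_scale.
- by apply: fall_mul => //; exact: leq_trans dd.
Qed.

Lemma fall_mulW H d f g a b : fall_space H d g ->
  (mdegree f <= a)%N -> (mdegree g <= b)%N -> (a + b <= d)%N ->
  fall_space H d (f * g).
Proof.
move=> hg fa gb abd; apply: fall_mul => //.
by rewrite (leq_trans (mdegreeM_le _ _)) // (leq_trans (leq_add fa gb)).
Qed.

Lemma fall_in_ideal H d f : fall_space H d f -> in_ideal H f.
Proof.
elim=> {f} [f fH _||f g _ hf _ hg|a f _ hf|g h _ hg _].
- exact: in_ideal_mem.
- exact: in_ideal0.
- exact: in_idealD.
- by rewrite -mul_mpolyC; exact: in_idealM.
- exact: in_idealM.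
Qed.

Lemma in_ideal_meval H f (x : 'I_v -> K) :
  (forall g, g \in H -> g.@[x] = 0) -> in_ideal H f -> f.@[x] = 0.
Proof. exact: (@in_ideal_rmorph _ _ (meval x)). Qed.

Lemma fall_meval H d f (x : 'I_v -> K) :
  (forall g, g \in H -> g.@[x] = 0) -> fall_space H d f -> f.@[x] = 0.
Proof. by move=> hx /fall_in_ideal; exact: in_ideal_meval. Qed.

(** A multiplier [h] is split into monomials, and each monomial into variables. Degrees add over a
    field, so every monomial of [h] times [g] has degree at most [d], and so have the intermediate
    products. *)
Lemma fall_ind_var H d (P : {mpoly K[v]} -> Prop) :
  (forall f, f \in H -> (mdegree f <= d)%N -> P f) -> P 0 ->
  (forall f g, fall_space H d f -> fall_space H d g -> P f -> P g -> P (f + g)) ->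
  (forall a f, fall_space H d f -> P f -> P (a *: f)) ->
  (forall i f, fall_space H d f -> (mdegree f < d)%N -> P f -> P ('X_i * f)) ->
  forall f, fall_space H d f -> P f.
Proof.
move=> Pgen P0 PD PZ PX f; elim=> {f} [f fH fd||f g hf Pf hg Pg|a f hf Pf|g h hg Pg].
- exact: Pgen.
- exact: P0.
- exact: PD.
- exact: PZ.
have [->|h0] := eqVneq h 0; first by rewrite mul0r.
have [->|g0] := eqVneq g 0; first by rewrite mulr0.
rewrite mdegreeM // => hgd.
suff key e : (mdeg e + mdegree g <= d)%N ->
    fall_space H d ('X_[e] * g) /\ P ('X_[e] * g).
  suff [] : fall_space H d (h * g) /\ P (h * g) by [].
  have -> : h * g = \sum_(e <- msupp h) (h@_e *: 'X_[e]) * g.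
    by rewrite {1}(mpolyE h) mulr_suml.
  rewrite big_seq.
  apply: (big_ind (fun f => fall_space H d f /\ P f)) => //.
  - by split=> //; exact: fall_zero.
  - by move=> x y [hx Px] [hy Py]; split; [exact: fall_add|exact: PD].
  move=> e eh; have [|h1 h2] := key e.
    by apply: leq_trans hgd; rewrite leq_add2r mdeg_mdegree.
  by rewrite -scalerAl; split; [exact: fall_scale|exact: PZ].
have [n] := ubnP (mdeg e); elim: n e => // n IH e en ed.
have [->|/mnm_neq0_split[i Ee]] := eqVneq e 0%MM; first by rewrite mpolyX0 mul1r.
have de : mdeg e = (mdeg (e - U_(i))%MM).+1 by rewrite {1}Ee mdegD mdeg1.
have [||h1 h2] := IH (e - U_(i))%MM; try lia.
have X0 : 'X_[e - U_(i)] != 0 :> {mpoly K[v]} by rewrite -msize_poly_eq0 msizeX.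
have dd : (mdegree ('X_[e - U_(i)] * g) < d)%N.
  by rewrite mdegreeM // mdegreeX; lia.
rewrite Ee mpolyXD -mulrA; split; last exact: PX.
by apply: (fall_mulW (a := 1) (b := d.-1)); rewrite ?mdegreeX ?mdeg1 //; lia.
Qed.

End FallSpace.

(** * Reduction modulo the polynomials [X^M - X] *)

Section Reduction.
Variables (K : fieldType) (N M : nat).
Hypothesis M1 : (1 < M)%N.
Implicit Types (f g h : {mpoly K[N]}).

Definition reduced g :=
  forall mu, mu \in msupp g -> forall x : 'I_N, (mu x <= M.-1)%N.

Lemma reduced0 : reduced 0.
Proof. by move=> mu; rewrite msupp0. Qed.

Lemma reducedD f g : reduced f -> reduced g -> reduced (f + g).
Proof.
move=> hf hg mu /msuppD_le; rewrite mem_cat => /orP[]; [exact: hf|exact: hg].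
Qed.

Lemma reducedZ c f : reduced f -> reduced (c *: f).
Proof. by move=> hf mu /msuppZ_le; exact: hf. Qed.

(** In a monomial with an exponent at least [M], a factor [X_x^M] is replaced by [X_x]. This
    subtracts a monomial multiple of a member of [H], within the degree of the monomial, and lowers
    the degree by [M - 1]. *)
Lemma reduction H f :
  (forall x : 'I_N, 'X_x ^+ M - 'X_x \in H) ->
  exists g, [/\ fall_space H (maxn M (mdegree f)) (f - g), reduced g
              & (mdegree g <= mdegree f)%N].
Proof.
move=> HH.
have mono n e : (mdeg e < n)%N -> exists g,
    [/\ fall_space H (maxn M (mdeg e)) ('X_[e] - g), reduced g
      & (mdegree g <= mdeg e)%N].
  elim: n e => // n IH e en.
  have [/forallP hred|] := boolP [forall x, e x <= M.-1]%N.
    exists 'X_[e]; rewrite subrr mdegreeX; split=> //; first exact: fall_zero.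
    by move=> mu; rewrite msuppX inE => /eqP->.
  rewrite negb_forall => /existsP[x]; rewrite -ltnNge => ex.
  pose e' := (e - U_(x) *+ M)%MM.
  have Ee : e = (e' + U_(x) *+ M)%MM.
    rewrite submK //; apply/mnm_lepP => y; rewrite mulmnE mnm1E.
    by case: eqVneq => [<-|_]; rewrite ?mul1n ?mul0n //; lia.
  have de : mdeg e = (mdeg e' + M)%N by rewrite Ee mdegD mdegMn mdeg1 mul1n.
  have [|g [h1 h2 h3]] := IH (e' + U_(x))%MM; first by rewrite mdegD mdeg1; lia.
  rewrite mdegD mdeg1 in h1 h3.
  exists g; split=> //; last by lia.
  have -> : 'X_[e] - g = 'X_[e'] * ('X_x ^+ M - 'X_x) + ('X_[e' + U_(x)] - g).
    by rewrite {1}Ee !mpolyXD mulrBr mpolyXn addrA subrK.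
  have dX : (mdegree ('X_x ^+ M - 'X_x : {mpoly K[N]}) <= M)%N.
    by rewrite mdegreeB // ?mpolyXn mdegreeX ?mdegMn mdeg1 ?mul1n // ltnW.
  apply: fall_add; last by apply: fall_leq h1 => //; lia.
  apply: (fall_mulW (a := mdeg e') (b := M)) => //.
  - by apply: fall_gen => //; rewrite (leq_trans dX) // leq_maxl.
  - by rewrite mdegreeX.
  - by rewrite -de leq_maxr.
have gen (s : seq 'X_{1..N}) : {subset s <= msupp f} -> exists g,
    [/\ fall_space H (maxn M (mdegree f))
          (\sum_(e <- s) f@_e *: 'X_[e] - g), reduced g
      & (mdegree g <= mdegree f)%N].
  elim: s => [|e s IH] hs.
    exists 0; rewrite big_nil subrr mdegree0; split=> //.
      exact: fall_zero.
    exact: reduced0.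
  have [|g [h1 h2 h3]] := IH; first by move=> y ys; rewrite hs // inE ys orbT.
  have ef : (mdeg e <= mdegree f)%N by rewrite mdeg_mdegree ?hs ?mem_head.
  have [g' [h4 h5 h6]] := mono _ e (ltnSn _).
  exists (f@_e *: g' + g); split; last 1 first.
  - by rewrite mdegreeD // (leq_trans (mdegreeZ _ _)) // (leq_trans h6).
  - rewrite big_cons opprD addrACA -scalerBr; apply: fall_add => //.
    by apply: fall_scale; apply: fall_leq h4 => //; lia.
  - by apply: reducedD => //; exact: reducedZ.
by have [|g] := gen (msupp f); rewrite -?mpolyE //; exists g.
Qed.

(* The inverse Vandermonde matrix of the grid yields dual functionals that
   read off the coefficients of a reduced polynomial from its values. *)
Lemma reduced_eq0 (a : 'I_M -> K) g : injective a -> reduced g ->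
  (forall x : {ffun 'I_N -> 'I_M}, g.@[fun i => a (x i)] = 0) -> g = 0.
Proof.
move=> ainj gred g0.
pose V : 'M[K]_M := \matrix_(i, j) a j ^+ i.
have Vunit : V \in unitmx.
  have -> : V = Vandermonde M (\row_j a j) by apply/matrixP=> i j; rewrite !mxE.
  rewrite unitmxE det_Vandermonde unitfE prodf_seq_neq0; apply/allP => i _ /=.
  rewrite prodf_seq_neq0; apply/allP => j _; apply/implyP => ij.
  by rewrite !mxE subr_eq0 (inj_eq ainj) -val_eqE /= gtn_eqF.
pose B := invmx V.
have dual (b e : 'I_M) : \sum_(j < M) a j ^+ b * B j e = (b == e)%:R.
  have := mulmxV Vunit => /matrixP/(_ b e); rewrite !mxE => <-.
  by apply: eq_bigr => j _; rewrite !mxE.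
have lt_red mu x : mu \in msupp g -> (mu x < M)%N.
  by move=> /gred/(_ x); lia.
apply/mpolyP => e; rewrite mcoeff0.
have [ge|/memN_msupp_eq0 //] := boolP (e \in msupp g).
pose oe x := Ordinal (lt_red e x ge).
have : \sum_(x : {ffun 'I_N -> 'I_M}) g.@[fun i => a (x i)] *
    \prod_i B (x i) (oe i) = 0.
  by apply: big1 => x _; rewrite g0 mul0r.
under eq_bigr do rewrite mevalE mulr_suml.
rewrite exchange_big /= (bigD1_seq e) ?msupp_uniq //=.
have term mu : mu \in msupp g ->
    \sum_(x : {ffun 'I_N -> 'I_M}) g@_mu * \prod_i a (x i) ^+ mu i *
      \prod_i B (x i) (oe i) = g@_mu * (mu == e)%:R.
  move=> gmu; under eq_bigr do rewrite -mulrA -big_split /=.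
  rewrite -mulr_sumr; congr (_ * _).
  rewrite -(bigA_distr_bigA (fun i j => a j ^+ mu i * B j (oe i))) /=.
  under eq_bigr => i _ do rewrite (dual (Ordinal (lt_red mu i gmu)) (oe i)).
  have [E|ne] := eqVneq mu e.
    by rewrite big1 // => i _; rewrite -val_eqE /= E eqxx.
  have /existsP[i ni] : [exists i, mu i != e i].
    rewrite -negb_forall; apply: contra ne => /forallP H.
    by apply/eqP/mnmP => i; apply/eqP.
  by rewrite (bigD1 i) //= -val_eqE /= (negPf ni) mul0r.
rewrite term // eqxx mulr1 big_seq_cond big1 ?addr0 // => mu /andP[gmu /negPf ne].
by rewrite term // ne mulr0.
Qed.

End Reduction.

(** * Powers of Frobenius as ring morphisms *)

Section FrobeniusPower.
Variables (R : comNzRingType) (Q : nat).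
Hypothesis hQ : [pchar R].-nat Q.

(** The proof that [Q] is a power of the characteristic is an argument, so that the morphism
    structures can be attached to the function itself. *)
Definition frob_pow of [pchar R].-nat Q := fun x : R => x ^+ Q.
Local Notation frob := (frob_pow hQ).

Lemma frob_pow_is_zmod : zmod_morphism frob.
Proof.
move=> x y; rewrite /frob_pow exprDn_pchar //; congr (_ + _).
apply/eqP; rewrite -addr_eq0 -exprDn_pchar // addNr expr0n.
by case: Q hQ => //.
Qed.

Lemma frob_pow_is_monoid : monoid_morphism frob.
Proof. by split; rewrite /frob_pow ?expr1n // => x y; rewrite exprMn. Qed.

HB.instance Definition _ := GRing.isZmodMorphism.Build R R frob frob_pow_is_zmod.
HB.instance Definition _ := GRing.isMonoidMorphism.Build R R frob frob_pow_is_monoid.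

End FrobeniusPower.

Lemma pnat_pchar_eq0 (R : nzRingType) n :
  [pchar R].-nat n -> (1 < n)%N -> n%:R = 0 :> R.
Proof.
move=> hn n1; have hp := pnatPpi hn; rewrite -pi_pdiv in n1.
by apply/eqP; rewrite -(dvdn_pcharf (hp _ n1)) pdiv_dvd.
Qed.

Lemma meval_rmorph (R S : comNzRingType) (phi : {rmorphism R -> S}) n
    (f : {mpoly R[n]}) (x : 'I_n -> R) :
  phi f.@[x] = (map_mpoly phi f).@[phi \o x].
Proof.
elim/mpolyind: f => [|c e f _ _ IH]; first by rewrite !raddf0.
rewrite !raddfD /= IH; congr (_ + _).
rewrite mevalZ map_mpolyZ map_mpolyX mevalZ !mevalX rmorphM rmorph_prod /=.
by congr (_ * _); apply: eq_bigr => i _; rewrite rmorphXn.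
Qed.

Lemma map_mpoly_inj (R S : nzRingType) (phi : {rmorphism R -> S}) n :
  injective phi -> injective (map_mpoly phi : {mpoly R[n]} -> {mpoly S[n]}).
Proof.
move=> inj f g /mpolyP E; apply/mpolyP => e.
by apply: inj; rewrite -!mcoeff_map_mpoly.
Qed.

Lemma msupp_map_mpoly_sub (R S : nzRingType) (phi : {rmorphism R -> S}) n
  (f : {mpoly R[n]}) : {subset msupp (map_mpoly phi f) <= msupp f}.
Proof.
move=> e; rewrite !mcoeff_msupp mcoeff_map_mpoly; apply: contra => /eqP->.
by rewrite raddf0.
Qed.

Lemma meval_horner_alg (R : comNzRingType) n (i : 'I_n) (c : {poly R}) x :
  (horner_alg ('X_i : {mpoly R[n]}) c).@[x] = c.[x i].
Proof.
elim/poly_ind: c => [|c a IH]; first by rewrite !raddf0 horner0.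
rewrite rmorphD rmorphM /= horner_algX horner_algC mevalD mevalM mevalXU IH.
by rewrite mevalZ meval1 mulr1 hornerMXaddC.
Qed.

Lemma map_mpoly_horner_alg (R S : comNzRingType) (phi : {rmorphism R -> S}) n
    (i : 'I_n) (c : {poly R}) :
  map_mpoly phi (horner_alg ('X_i : {mpoly R[n]}) c) =
  horner_alg 'X_i (map_poly phi c).
Proof.
elim/poly_ind: c => [|c a IH]; first by rewrite !raddf0.
rewrite !rmorphD !rmorphM /= !map_polyX !map_polyC !horner_algX !horner_algC.
by rewrite map_mpolyZ map_mpolyX rmorph1 IH.
Qed.

(** * The shape lemma for radical zero-dimensional ideals over a finite field *)

Section Shape.
Variables (k : finFieldType) (m : nat) (F : seq {mpoly k[m]}).
Variables (kbar : closedFieldType) (phi : {rmorphism k -> kbar}).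
Hypothesis hdim : zero_dimensional F.
Hypothesis hrad : radical_ideal F.
Local Notation Q := #|k|.
Hypothesis hQ : [pchar k].-nat Q.

Lemma pnat_card (R : nzRingType) (psi : {rmorphism k -> R}) j :
  [pchar R].-nat (Q ^ j)%N.
Proof.
rewrite pnatX; apply/orP; left; apply: sub_in_pnat hQ => p _.
exact: rmorph_pchar.
Qed.

(* R/I is finite, so two Frobenius iterates of the coordinates coincide in it;
   it is reduced, so the smaller power can be cancelled. *)
Lemma frob_fixed_exists : exists N, (0 < N)%N /\
  forall i : 'I_m, in_ideal F ('X_i ^+ (Q ^ N) - 'X_i).
Proof.
have [_ [B hB]] := hdim.
have hX (u : nat * 'I_m) : exists c : {ffun 'I_(size B) -> k},
    in_ideal F ('X_(u.2) ^+ (Q ^ u.1) - \sum_(l < size B) c l *: B`_l).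
  have [c hc] := hB ('X_(u.2) ^+ (Q ^ u.1)); exists (finfun c).
  by under eq_bigr do rewrite ffunE.
pose T : finType := {ffun 'I_m -> {ffun 'I_(size B) -> k}}.
have hT (j : 'I_(#|T|.+1)) : exists c : T, forall i,
    in_ideal F ('X_i ^+ (Q ^ j) - \sum_(l < size B) c i l *: B`_l).
  have [c hc] := fin_all_exists (fun i => hX (nat_of_ord j, i)).
  by exists (finfun c) => i; rewrite ffunE; exact: hc.
have [c hc] := fin_all_exists hT.
have /injectivePn[j1 [j2 j12 cj]] : ~~ injectiveb c.
  by apply/negP => /injectiveP/leq_card; rewrite card_ord ltnn.
wlog lt12 : j1 j2 j12 cj / (j1 < j2)%N.
  move=> W; have [|] := ltnP j1 j2; first exact: W.
  rewrite leq_eqVlt => /orP[/eqP/val_inj E|]; first by rewrite E eqxx in j12.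
  by apply: W; rewrite // eq_sym.
exists (j2 - j1)%N; split=> [|i]; first by rewrite subn_gt0.
apply: (hrad (e := (Q ^ j1)%N)).
have hQ1 := pnat_card (@mpolyC m k) j1.
have -> : ('X_i ^+ (Q ^ (j2 - j1)) - 'X_i) ^+ (Q ^ j1) =
    'X_i ^+ (Q ^ j2) - 'X_i ^+ (Q ^ j1) :> {mpoly k[m]}.
  have /= := rmorphB (frob_pow hQ1) ('X_i ^+ (Q ^ (j2 - j1))) 'X_i.
  by rewrite /frob_pow -exprM -expnD subnK ?(ltnW lt12).
have := in_idealB (hc j2 i) (hc j1 i).
by rewrite cj opprB addrA subrK.
Qed.


(** Raising to the power [Q^N] is a ring morphism that fixes both the coefficients, which come from
    [k], and the coordinates. *)
Lemma frob_fixed_meval (f : {mpoly k[m]}) N (x : 'I_m -> kbar) :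
  (forall i, x i ^+ (Q ^ N) = x i) ->
  (map_mpoly phi f).@[x] ^+ (Q ^ N) = (map_mpoly phi f).@[x].
Proof.
move=> hx; have hN := pnat_card phi N.
rewrite -[LHS]/(frob_pow hN _) meval_rmorph.
have -> : map_mpoly (frob_pow hN) (map_mpoly phi f) = map_mpoly phi f.
  apply/mpolyP => e; rewrite !mcoeff_map_mpoly /= /frob_pow -rmorphXn.
  by congr (phi _); elim: N {hx hN} => // N IH; rewrite expnSr exprM IH expf_card.
by apply: meval_eq => i /=; exact: hx.
Qed.

(* The product P of the 1 - f^(M-1) is congruent to 1 modulo I and, on the grid of
   fixed points of x -> x^M, is the indicator function of the zeros of F; so
   g * P vanishes on the whole grid. *)
Lemma vanishing_in_ideal g :
  (forall z : m.-tuple kbar, zero_locus phi F z ->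
     (map_mpoly phi g).@[tnth z] = 0) -> in_ideal F g.
Proof.
move=> hg; have [N [N0 hN]] := frob_fixed_exists; set M := (Q ^ N)%N in hN.
have M1 : (1 < M)%N.
  by rewrite (leq_trans (finNzRing_gt1 k)) // -{1}(expn1 Q) leq_exp2l ?finNzRing_gt1.
(* The grid is built on the roots of ['X^M - 'X]; there are [M] distinct ones because the derivative
   is [-1]. *)
have [rs Ers] := closed_field_poly_normal ('X^M - 'X : {poly kbar}).
have lc : lead_coef ('X^M - 'X : {poly kbar}) = 1.
  by rewrite lead_coefDl ?lead_coefXn // size_polyN size_polyX size_polyXn.
rewrite lc scale1r in Ers.
have urs : uniq rs.
  rewrite -separable_prod_XsubC -Ers separable_poly.unlock derivB derivXn derivX.
  rewrite -scaler_nat (pnat_pchar_eq0 (pnat_card phi N) M1) scale0r sub0r.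
  by rewrite -[X in coprimep _ X]scaleN1r coprimepZr ?coprimep1 // oppr_eq0 oner_eq0.
have srs : size rs = M.
  have := size_prod_XsubC rs id; rewrite -Ers.
  by rewrite size_addl size_polyXn ?size_polyN ?size_polyX // => -[].
have rsP x : x \in rs -> x ^+ M = x.
  rewrite -root_prod_XsubC -Ers /root !hornerE subr_eq0.
  by move/eqP.
pose a (i : 'I_M) := rs`_i.
have ainj : injective a.
  by move=> i j /eqP; rewrite nth_uniq ?srs // => /eqP/val_inj.
have aP i : a i ^+ M = a i by apply: rsP; rewrite mem_nth ?srs.
pose P := \prod_(f <- F) (1 - f ^+ M.-1).
have hP : in_ideal F (1 - P).
  rewrite /P big_seq.
  apply: (big_ind (fun P => in_ideal F (1 - P))) => [|x y hx hy|f fF].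
  - by rewrite subrr; exact: in_ideal0.
  - have -> : 1 - x * y = (1 - x) + x * (1 - y) by rewrite mulrBr mulr1 addrA subrK.
    by apply: in_idealD => //; exact: in_idealM.
  - rewrite opprB addrC subrK -(prednK (ltnW M1)).
    have -> : M.-1 = M.-2.+1 by lia.
    by rewrite exprS; apply/in_idealMr/in_ideal_mem.
(* The reduced form [g0] of [g * P] has the same values on the grid, so it is zero; hence [g * P]
   lies in the ideal of the ['X_i ^+ M - 'X_i], all of which belong to the ideal of [F]. *)
have [g0 [h1 h2 h3]] := reduction M1 (H := [seq 'X_i ^+ M - 'X_i | i <- enum 'I_m])
  (g * P) (fun x => map_f (fun i => 'X_i ^+ M - 'X_i) (mem_enum _ x)).
have Eg0 : g0 = 0.
  apply: (map_mpoly_inj (fmorph_inj phi)); rewrite raddf0.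
  apply: (reduced_eq0 M1 ainj).
    by move=> mu /msupp_map_mpoly_sub; exact: h2.
  move=> x; set y := fun i => a (x i).
  have yP i : y i ^+ M = y i by exact: aP.
  have : (map_mpoly phi (g * P - g0)).@[y] = 0.
    have := fall_in_ideal h1.
    apply: (@in_ideal_rmorph _ _ (meval y \o map_mpoly phi)).
    move=> _ /mapP[i _ ->] /=.
    by rewrite rmorphB rmorphXn /= map_mpolyX mevalB rmorphXn /= mevalXU yP subrr.
  rewrite rmorphB mevalB /= => /eqP; rewrite subr_eq0 => /eqP <-.
  rewrite rmorphM mevalM /=.
  have [/allP hz|/allPn[f fF fy]] :=
      boolP (all (fun f => (map_mpoly phi f).@[y] == 0) F).
    have := hg [tuple y i | i < m] _.
    rewrite (meval_eq (v2 := y)); last by move=> i; rewrite tnth_mktuple.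
    move=> -> //; first by rewrite mul0r.
    move=> f fF; rewrite (meval_eq (v2 := y)); last by move=> i; rewrite tnth_mktuple.
    exact/eqP/hz.
  rewrite /P (big_rem f) //= rmorphM mevalM /= rmorphB mevalB /= rmorph1 meval1.
  rewrite rmorphXn /= rmorphXn /=.
  have -> : (map_mpoly phi f).@[y] ^+ M.-1 = 1.
    apply: (mulfI fy); rewrite mulr1 -exprS prednK ?(ltnW M1) //.
    exact: frob_fixed_meval.
  by rewrite subrr mul0r mulr0.
rewrite Eg0 subr0 in h1.
have -> : g = g * P + g * (1 - P) by rewrite -mulrDr addrC subrK mulr1.
apply: in_idealD; last exact: in_idealM.
apply: in_ideal_subset (fall_in_ideal h1) => _ /mapP[i _ ->].
exact: hN.
Qed.


(** The polynomial [X^Q - X] is the product of the [X - a] over [a] in [k], so its roots in [kbar]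
    are the images of elements of [k]. *)
Lemma frob_fixed_im (x : kbar) : x ^+ Q = x -> exists a, phi a = x.
Proof.
move=> hx; have : root (map_poly phi ('X^Q - 'X)) x.
  by rewrite rmorphB /= map_polyXn map_polyX /root !hornerE hx subrr.
rewrite finField_genPoly rmorph_prod /=.
under eq_bigr do rewrite rmorphB /= map_polyX map_polyC /=.
rewrite /root horner_prod prodf_seq_eq0 => /hasP[a _ /=].
by rewrite hornerXsubC subr_eq0 => /eqP->; exists a.
Qed.

Lemma frob_fixed_poly (p : {poly kbar}) :
  (forall i, p`_i ^+ Q = p`_i) -> exists p0, map_poly phi p0 = p.
Proof.
move=> hp; pose c i := odflt 0 [pick a | phi a == p`_i].
exists (\poly_(i < size p) c i); apply/polyP => i.
rewrite coef_map coef_poly; case: ltnP => ip; last first.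
  by rewrite raddf0 nth_default.
rewrite /c; case: pickP => [a /eqP //|/= H].
by have [a ea] := frob_fixed_im (hp i); have := H a; rewrite ea eqxx.
Qed.

(** * Frobenius on the zero set, and interpolation over [k] *)

Section Points.
Variables (Z : seq (m.-tuple kbar)) (t : 'I_m).
Hypothesis hZ : forall z, zero_locus phi F z <-> z \in Z.
Hypothesis uZ : uniq Z.
Hypothesis hproj : {in Z &, injective (fun z => tnth z t)}.

Definition frob_pt (z : m.-tuple kbar) := [tuple tnth z i ^+ Q | i < m].

Lemma frob_ptP z : z \in Z -> frob_pt z \in Z.
Proof.
move=> /hZ hz; apply/hZ => f fF.
have hN := pnat_card phi 1; rewrite expn1 in hN.
have := congr1 (frob_pow hN) (hz f fF); rewrite rmorph0 meval_rmorph.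
have -> : map_mpoly (frob_pow hN) (map_mpoly phi f) = map_mpoly phi f.
  apply/mpolyP => e; rewrite !mcoeff_map_mpoly /= /frob_pow -rmorphXn.
  by rewrite expf_card.
by move=> <-; apply: meval_eq => i; rewrite tnth_mktuple.
Qed.

Lemma frob_pt_inj : injective frob_pt.
Proof.
move=> z1 z2 E; apply: eq_from_tnth => i.
have hN := pnat_card phi 1; rewrite expn1 in hN.
apply: (fmorph_inj (frob_pow hN)).
by have := congr1 (fun z => tnth z i) E; rewrite !tnth_mktuple.
Qed.

Lemma frob_pt_surj z : z \in Z -> exists2 z', z' \in Z & z = frob_pt z'.
Proof.
have hs : {subset map frob_pt Z <= Z} by move=> _ /mapP[z' hz' ->]; exact: frob_ptP.
have um : uniq (map frob_pt Z) by rewrite (map_inj_uniq frob_pt_inj).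
have [|_ E] := uniq_min_size um hs; first by rewrite size_map.
by rewrite -E => /mapP[z' hz' ->]; exists z'.
Qed.

Lemma poly_vanish_eq0 (p : {poly kbar}) : (size p <= size Z)%N ->
  (forall z, z \in Z -> p.[tnth z t] = 0) -> p = 0.
Proof.
move=> sp hp; apply/eqP; apply: contraTT sp => p0; rewrite -ltnNge.
rewrite -(size_map (fun z => tnth z t)); apply: max_poly_roots => //.
  by apply/allP => _ /mapP[z hz ->]; rewrite /root hp.
by rewrite map_inj_in_uniq.
Qed.

(** Lagrange interpolation at the [t]-coordinates, which are distinct. Frobenius permutes [Z] and is
    compatible with [w], so applying it to the coefficients gives a second interpolant of the same
    size; by uniqueness the coefficients are fixed and come from [k]. *)
Lemma interpolation (w : m.-tuple kbar -> kbar) :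
  (forall z, z \in Z -> w (frob_pt z) = w z ^+ Q) ->
  exists p : {poly k}, (size p <= size Z)%N /\
    forall z, z \in Z -> (map_poly phi p).[tnth z t] = w z.
Proof.
move=> hw; pose L z := \prod_(x <- [seq tnth y t | y <- rem z Z]) ('X - x%:P).
have memT z z1 : z \in Z -> z1 \in Z ->
    (tnth z1 t \in [seq tnth y t | y <- rem z Z]) = (z1 != z).
  move=> hz hz1; apply/mapP/idP => [[y]|ne].
    rewrite mem_rem_uniq // inE => /andP[yz yZ] E.
    by rewrite (hproj hz1 yZ E).
  by exists z1 => //; rewrite mem_rem_uniq // inE ne.
pose p := \sum_(z <- Z) (w z / (L z).[tnth z t]) *: L z.
have hp z : z \in Z -> p.[tnth z t] = w z.
  move=> hz; rewrite /p horner_sum (bigD1_seq z) //= big_seq_cond big1 ?addr0.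
    rewrite hornerZ divfK //; apply/negP; rewrite -/(root _ _) root_prod_XsubC.
    by rewrite memT // eqxx.
  move=> z1 /andP[hz1 ne]; rewrite hornerZ.
  have /rootP-> : root (L z1) (tnth z t); last by rewrite mulr0.
  by rewrite root_prod_XsubC memT // eq_sym.
have sp : (size p <= size Z)%N.
  rewrite /p big_seq; apply: (leq_trans (size_sum _ _ _)).
  apply/bigmax_leqP_seq => z _ hz; rewrite (leq_trans (size_scale_leq _ _)) //.
  rewrite size_prod_XsubC size_map size_rem // prednK //.
  by case: (Z) hz.
have hN := pnat_card phi 1; rewrite expn1 in hN.
have [|p0 Ep] := @frob_fixed_poly p.
  suff E : map_poly (frob_pow hN) p = p.
    by move=> i; rewrite -[in RHS]E coef_map.
  apply/eqP; rewrite -subr_eq0; apply/eqP; apply: poly_vanish_eq0.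
    rewrite (leq_trans (size_polyD _ _)) // geq_max size_polyN sp andbT.
    by rewrite (leq_trans (size_poly _ _)).
  move=> _ /frob_pt_surj[z hz ->]; rewrite hornerD hornerN hp ?frob_ptP //.
  have -> : tnth (frob_pt z) t = frob_pow hN (tnth z t) by rewrite tnth_mktuple.
  by rewrite horner_map hp // hw // subrr.
exists p0; rewrite Ep; split=> //.
by rewrite -(size_map_poly phi) Ep.
Qed.

End Points.

(** [P i] interpolates the [i]-th coordinate as a function of the [t]-th, [f] vanishes at the
    [t]-coordinates of the zeros, and [s0] is their number. Ideal membership follows from vanishing
    on the zero set. [P t] is only congruent to ['X] modulo [f], since it is constant when there is
    a single zero. *)
Lemma shape_lemma s :
  (exists Z : seq (m.-tuple kbar),
        (size Z <= s)%N /\ forall z, zero_locus phi F z -> z \in Z) ->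
  (exists t : 'I_m, forall z1 z2 : m.-tuple kbar,
        zero_locus phi F z1 -> zero_locus phi F z2 ->
        tnth z1 t = tnth z2 t -> z1 = z2) ->
  exists (t : 'I_m) (f : {poly k}) (P : 'I_m -> {poly k}) (s0 : nat),
    [/\ f \is monic, size f = s0.+1, (0 < s0 <= s)%N &
        in_ideal F (horner_alg 'X_t f)] /\
    [/\ forall i, (size (P i) <= s0)%N,
        forall i, in_ideal F ('X_i - horner_alg 'X_t (P i)),
        f %| 'X - P t &
        forall rho, root f rho -> forall g, g \in F ->
          g.@[fun i => (P i).[rho]] = 0].
Proof.
move=> [Z1 [sZ1 hZ1]] [t ht].
pose zero z := all (fun f => (map_mpoly phi f).@[tnth z] == 0) F.
have zeroP z : reflect (zero_locus phi F z) (zero z).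
  apply: (iffP allP) => [H f fF|H f fF]; first exact/eqP/H.
  by apply/eqP/H.
pose Z := undup (filter zero Z1).
have hZ z : zero_locus phi F z <-> z \in Z.
  rewrite mem_undup mem_filter; split=> [hz|/andP[/zeroP //]].
  by rewrite hZ1 // andbT; apply/zeroP.
have uZ : uniq Z by exact: undup_uniq.
have sZ : (size Z <= s)%N.
  apply: leq_trans (size_undup _) (leq_trans _ sZ1).
  by rewrite size_filter count_size.
have inj : {in Z &, injective (fun z => tnth z t)}.
  by move=> z1 z2 /hZ h1 /hZ h2; exact: ht.
(* Interpolating the power [size Z] of the [t]-coordinate yields [f] as ['X^(size Z) - c], directly
   with coefficients in [k]. *)
have [|c [sc hc]] := interpolation hZ uZ inj (w := fun z => tnth z t ^+ size Z).
  by move=> z _; rewrite tnth_mktuple exprAC.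
have hP i : exists p : {poly k}, (size p <= size Z)%N /\
    forall z, z \in Z -> (map_poly phi p).[tnth z t] = tnth z i.
  by apply: interpolation => // z _; rewrite tnth_mktuple.
have [P hP'] := fin_all_exists hP.
pose f := 'X^(size Z) - c.
have sf : size f = (size Z).+1.
  by rewrite size_polyDl size_polyXn // size_polyN ltnS.
have mf : f \is monic.
  by rewrite monicE lead_coefDl ?lead_coefXn // size_polyN size_polyXn ltnS.
have f0 z : z \in Z -> (map_poly phi f).[tnth z t] = 0.
  by move=> hz; rewrite rmorphB /= map_polyXn !hornerE hc // subrr.
exists t, f, P, (size Z); split; split=> //.
(* Without zeros, [1] would vanish on the zero set and lie in the ideal, which zero-dimensionality
   excludes. *)
- rewrite sZ andbT lt0n size_eq0; apply/eqP => Z0.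
  have [h1 _] := hdim; apply: h1; apply: vanishing_in_ideal => z /hZ.
  by rewrite Z0.
- apply: vanishing_in_ideal => z /hZ hz.
  by rewrite map_mpoly_horner_alg meval_horner_alg f0.
- by move=> i; have [] := hP' i.
- move=> i; apply: vanishing_in_ideal => z /hZ hz.
  rewrite rmorphB /= map_mpolyX map_mpoly_horner_alg mevalB mevalXU.
  by rewrite meval_horner_alg (hP' i).2 // subrr.
- rewrite -[_ %| _]/(_ %% f == 0) -(map_poly_eq0 phi); apply/eqP.
  apply: (poly_vanish_eq0 uZ inj).
    by rewrite size_map_poly -ltnS -sf ltn_modp monic_neq0.
  move=> z hz; have /(congr1 (map_poly phi)) := divp_eq ('X - P t) f.
  rewrite rmorphB rmorphD rmorphM /= map_polyX => /(congr1 (fun p => p.[tnth z t])).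
  by rewrite !hornerE (hP' t).2 // f0 // mulr0 add0r subrr.
- move=> rho hrho g gF.
  (* The degree of [f] is [size Z], and the [t]-coordinates already provide that many roots. *)
  have : phi rho \in [seq tnth z t | z <- Z].
    apply/negPn/negP => nin.
    have := @max_poly_roots _ (map_poly phi f) (phi rho :: [seq tnth z t | z <- Z]).
    rewrite map_poly_eq0 monic_neq0 // => /(_ isT).
    rewrite /= size_map_poly sf size_map ltnn => H; apply/notF/H.
      rewrite fmorph_root hrho; apply/allP => _ /mapP[z hz ->].
      by rewrite /root f0.
    by rewrite nin map_inj_in_uniq.
  case/mapP => z hz Ez; apply: (fmorph_inj phi); rewrite rmorph0 meval_rmorph.
  have /hZ/(_ g gF) <- := hz; apply: meval_eq => i /=.
  by rewrite -horner_map Ez (hP' i).2.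
Qed.

End Shape.

Lemma mdegree_map (K L : fieldType) (phi : {rmorphism K -> L}) v
  (f : {mpoly K[v]}) : (mdegree (map_mpoly phi f) <= mdegree f)%N.
Proof.
by apply/mdegree_leP => e /msupp_map_mpoly_sub; exact: mdeg_mdegree.
Qed.

Lemma modp_expl (K : fieldType) (p d : {poly K}) a :
  (p %% d) ^+ a %% d = p ^+ a %% d.
Proof.
elim: a => [|a IH] //.
by rewrite exprSr modp_mul mulrC -modp_mul IH modp_mul -exprS.
Qed.

(** * The Weil descent system and its values at [k']-rational points *)

Section Weil.
Variables (q n m : nat) (k k' : finFieldType) (iota : {rmorphism k' -> k}).
Variables (F : seq {mpoly k[m]}) (alpha : 'I_n -> k).
Variable W : {mpoly k[m]} -> 'I_n -> {mpoly k'[m * n]}.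
Hypothesis q1 : (1 < q)%N.
Hypothesis hq : [pchar k].-nat q.
Hypothesis hk' : #|k'| = q.
Hypothesis halpha : is_basis iota alpha.
Hypothesis hW : forall f, f \in F -> is_weil_descent iota q alpha f (W f).

Local Notation S := {mpoly k[m * n]}.
Local Notation idx := mxvec_index.

(** Scalars are extended to [k], where the conjugate linear forms have their coefficients;
    [weil_coord_descent] returns to [k']. *)
Definition ext_system : seq S := map (map_mpoly iota) (weil_system q F W).
Local Notation V := (fall_space ext_system).

Definition kpt (y : 'I_(m * n) -> k') : 'I_(m * n) -> k := iota \o y.

Definition weil_pt (y : 'I_(m * n) -> k') (i : 'I_m) : k :=
  \sum_(l < n) alpha l * iota (y (idx i l)).

Lemma iota_frob (x : k') j : iota x ^+ (q ^ j) = iota x.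
Proof.
rewrite -rmorphXn /=; congr (iota _).
by elim: j => // j IH; rewrite expnSr exprM IH -hk' expf_card.
Qed.

Lemma field_eqs_mem (A : nzRingType) (x : 'I_(m * n)) :
  'X_x ^+ q - 'X_x \in field_eqs q m n A.
Proof.
case/mxvec_indexP: x => i l.
apply/allpairsP; exists (i, l); split; rewrite ?mem_enum //.
Qed.

Lemma field_eqs_meval f y : f \in field_eqs q m n k -> f.@[kpt y] = 0.
Proof.
move=> /allpairsP[[i l] [_ _ ->]] /=; rewrite /Xvar mevalB rmorphXn /= mevalXU.
by have := iota_frob (y (idx i l)) 1; rewrite expn1 /kpt /= => ->; rewrite subrr.
Qed.

Lemma field_eqs_sub : {subset field_eqs q m n k <= ext_system}.
Proof.
move=> f /allpairsP[[i l] [hi hl ->]]; apply/mapP.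
exists (Xvar k' i l ^+ q - Xvar k' i l).
  by rewrite mem_cat; apply/orP; right; apply/allpairsP; exists (i, l).
by rewrite rmorphB rmorphXn /= map_mpolyX.
Qed.

Lemma reduced_values_eq0 (g : S) : reduced q g ->
  (forall y, g.@[kpt y] = 0) -> g = 0.
Proof.
move=> gred g0; pose a (i : 'I_q) : k' := enum_val (cast_ord (esym hk') i).
apply: (reduced_eq0 q1 (a := iota \o a)) => //.
  by move=> i j /fmorph_inj/enum_val_inj/cast_ord_inj.
by move=> x; exact: (g0 (a \o x)).
Qed.

Lemma field_reduction (h : S) :
  exists g : S, [/\ V (maxn q (mdegree h)) (h - g), reduced q g,
    (mdegree g <= mdegree h)%N & forall y, h.@[kpt y] = g.@[kpt y]].
Proof.
have [g [h1 h2 h3]] := reduction q1 h (field_eqs_mem k).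
exists g; split=> //.
  exact: fall_leq field_eqs_sub (leqnn _) h1.
move=> y; apply/eqP; rewrite -subr_eq0 -mevalB; apply/eqP.
by apply: fall_meval h1 => f; exact: field_eqs_meval.
Qed.

(** The reduced form of [h] vanishes at all [k']-rational points as well, so it is zero, and
    reduction itself writes [h] through field equations. From here on, congruences are verified on
    values, with only degrees left to bound. *)
Lemma fall_values0 d (h : S) : (q <= d)%N -> (mdegree h <= d)%N ->
  (forall y, h.@[kpt y] = 0) -> V d h.
Proof.
move=> qd hd h0; have [g [h1 h2 h3 h4]] := field_reduction h.
have g0 : g = 0 by apply: reduced_values_eq0 => // y; rewrite -h4.
rewrite g0 subr0 in h1; apply: fall_leq h1 => //.
by rewrite geq_max qd.
Qed.

Lemma fall_values d (h g : S) : (q <= d)%N -> (mdegree h <= d)%N ->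
  (mdegree g <= d)%N -> (forall y, h.@[kpt y] = g.@[kpt y]) -> V d h -> V d g.
Proof.
move=> qd hd gd hg Vh; rewrite -(subrK h g); apply: fall_add => //.
apply: fall_values0 => //; first exact: mdegreeB.
by move=> y; rewrite mevalB hg subrr.
Qed.

(** * Conjugate linear forms and lifts of low degree *)

Definition Lform i j : S := \sum_(l < n) alpha l ^+ (q ^ j) *: 'X_(idx i l).

Lemma mdegree_Lform i j : (mdegree (Lform i j) <= 1)%N.
Proof.
apply: mdegree_sum => l _; apply: leq_trans (mdegreeZ _ _) _.
by rewrite mdegreeX mdeg1.
Qed.

Lemma meval_Lform y i j : (Lform i j).@[kpt y] = weil_pt y i ^+ (q ^ j).
Proof.
have hqj : [pchar k].-nat (q ^ j)%N by rewrite pnatX hq.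
rewrite raddf_sum /= -[RHS]/(frob_pow hqj _) rmorph_sum /=; apply: eq_bigr => l _.
by rewrite mevalZ mevalXU /frob_pow exprMn iota_frob.
Qed.

(** The argument [j] is the position of the current digit: a digit [d] there contributes
    [Lform i j ^+ d], with value the power [d q^j] of the coordinate. *)
Fixpoint digit_prod i fuel j e : S :=
  if fuel is f.+1 then Lform i j ^+ (e %% q)%N * digit_prod i f j.+1 (e %/ q)%N
  else 1.

Definition Lpow i e := digit_prod i e 0 e.

Lemma mdegree_digit_prod i f j e :
  (mdegree (digit_prod i f j e) <= digit_sum q f e)%N.
Proof.
elim: f j e => [|f IH] j e /=; first by rewrite mdegreeC.
apply: leq_trans (mdegreeM_le _ _) (leq_add _ (IH _ _)).
by apply: leq_trans (mdegree_exp _ _) _; rewrite -[leqRHS]mul1n leq_mul ?mdegree_Lform.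
Qed.

Lemma meval_digit_prod y i f j e : (e <= f)%N ->
  (digit_prod i f j e).@[kpt y] = weil_pt y i ^+ (e * q ^ j).
Proof.
elim: f j e => [|f IH] j e /=; first by rewrite leqn0 => /eqP->; rewrite meval1.
move=> ef; rewrite mevalM rmorphXn /= meval_Lform IH; last first.
  case: e ef => [|e] ef; first by rewrite div0n.
  by have := ltn_Pdiv q1 (ltn0Sn e); lia.
rewrite -exprM -exprD; congr (_ ^+ _).
by rewrite {3}(divn_eq e q) mulnDl expnS mulnA addnC (mulnC (q ^ j)%N).
Qed.

Lemma mdegree_Lpow i e : (mdegree (Lpow i e) <= weight q e)%N.
Proof. exact: mdegree_digit_prod. Qed.

Lemma meval_Lpow y i e : (Lpow i e).@[kpt y] = weil_pt y i ^+ e.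
Proof. by rewrite meval_digit_prod // muln1. Qed.

(** This takes the values of [g] at the points [weil_pt y], in degree bounded by weights instead of
    exponents. It is not multiplicative; products are compared by values. *)
Definition low_lift (g : {mpoly k[m]}) : S :=
  \sum_(e <- msupp g) g@_e *: \prod_i Lpow i (e i).

Lemma meval_low_lift y g : (low_lift g).@[kpt y] = g.@[weil_pt y].
Proof.
rewrite raddf_sum /= mevalE; apply: eq_bigr => e _.
rewrite mevalZ rmorph_prod /=; congr (_ * _).
by apply: eq_bigr => i _; rewrite meval_Lpow.
Qed.

Lemma mdegree_low_lift g d :
  (forall e, e \in msupp g -> (mon_weight q e <= d)%N) ->
  (mdegree (low_lift g) <= d)%N.
Proof.
move=> H; rewrite /low_lift big_seq; apply: mdegree_sum => e eg.
apply: leq_trans (mdegreeZ _ _) (leq_trans _ (H e eg)).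
by apply: mdegree_prod => i _; exact: mdegree_Lpow.
Qed.

(** * Coordinates in the basis: transport of fall spaces and descent to [k'] *)

Lemma basis_indep (c : 'I_n -> k') :
  \sum_(j < n) iota (c j) * alpha j = 0 -> forall j, c j = 0.
Proof.
move=> hc j; have [c0 [_ hu]] := halpha 0.
have e1 : c0 = finfun c.
  by apply: hu; rewrite -[LHS]hc; apply: eq_bigr => l _; rewrite ffunE.
have e2 : c0 = finfun (fun=> 0).
  by apply: hu; rewrite big1 // => l _; rewrite ffunE rmorph0 mul0r.
by have := congr1 (fun f : {ffun _} => f j) (etrans (esym e1) e2); rewrite !ffunE.
Qed.

Lemma mcoeff_weil (g : 'I_n -> {mpoly k'[m * n]}) e :
  (\sum_(j < n) alpha j *: map_mpoly iota (g j))@_e =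
  \sum_(j < n) iota (g j)@_e * alpha j.
Proof.
rewrite raddf_sum /=; apply: eq_bigr => j _.
by rewrite mcoeffZ mcoeff_map_mpoly mulrC.
Qed.

(** Independence of the basis prevents cancellation between the coordinates: a monomial of one [g j]
    survives in the sum. *)
Lemma mdegree_weil_coord (g : 'I_n -> {mpoly k'[m * n]}) j :
  (mdegree (g j) <= mdegree (\sum_(j < n) alpha j *: map_mpoly iota (g j)))%N.
Proof.
apply/mdegree_leP => e ej; apply: mdeg_mdegree.
rewrite mcoeff_msupp mcoeff_weil; apply/eqP => /basis_indep/(_ j)/eqP.
by apply/negP; rewrite -mcoeff_msupp.
Qed.

(** The combination [G] of the [W f j] is reduced and has the values of [low_lift f], so it is the
    reduced form of [low_lift f] and has degree at most [D]. Hence every [W f j] is a generator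
    available in degree [D]. *)
Lemma low_lift_gen D f : (q <= D)%N -> f \in F ->
  (forall e, e \in msupp f -> (mon_weight q e <= D)%N) -> V D (low_lift f).
Proof.
move=> qD fF fD; have [hid hred] := hW fF.
set G := \sum_(j < n) _ in hid.
have fd := mdegree_low_lift fD.
have Gval y : G.@[kpt y] = (low_lift f).@[kpt y].
  apply/eqP; rewrite eq_sym -subr_eq0 meval_low_lift.
  have := in_ideal_meval (fun g => @field_eqs_meval g y) hid.
  rewrite mevalB => <-; rewrite comp_mpoly_meval; apply/eqP; congr (_ - _).
  apply: meval_eq => i; rewrite tnth_mktuple raddf_sum /=.
  by apply: eq_bigr => l _; rewrite mevalZ mevalXU.
have Gred : reduced q G.
  move=> mu; rewrite mcoeff_msupp mcoeff_weil => nz x.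
  have /existsP[j hj] : [exists j, (W f j)@_mu != 0].
    rewrite -negb_forall; apply: contraNN nz => /forallP H.
    by rewrite big1 // => j _; rewrite (eqP (H j)) rmorph0 mul0r.
  by apply: (hred j); rewrite mcoeff_msupp.
have GD : (mdegree G <= D)%N.
  have [g [_ h2 h3 h4]] := field_reduction (low_lift f).
  suff -> : G = g by exact: leq_trans h3 fd.
  apply/eqP; rewrite -subr_eq0; apply/eqP/reduced_values_eq0.
    by apply: reducedD => //; rewrite -scaleN1r; exact: reducedZ.
  by move=> y; rewrite mevalB Gval h4 subrr.
have WD j := leq_trans (mdegree_weil_coord (W f) j) GD.
apply: (fall_values (h := G)) => //; apply: fall_sum => j _; apply: fall_scale.
apply: fall_gen; last exact: leq_trans (mdegree_map _ _) (WD j).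
apply: map_f; rewrite mem_cat; apply/orP; left.
by apply/allpairsP; exists (f, j); rewrite mem_enum.
Qed.

(** Multiplication by ['X_i] is matched by multiplication by [Lform i 0]. The successor in the
    hypothesis on weights leaves room for this linear factor. *)
Lemma low_lift_fall r D g : (q <= D)%N ->
  (forall e : 'X_{1..m}, (mdeg e < r)%N -> ((mon_weight q e).+1 <= D)%N) ->
  fall_space F r g -> V D (low_lift g).
Proof.
move=> qD HD.
(* Removing one variable brings the degree below [r], and putting it back raises the weight by at
   most one. *)
have wD (e : 'X_{1..m}) : (mdeg e <= r)%N -> (mon_weight q e <= D)%N.
  have [->|/mnm_neq0_split[i ->]] := eqVneq e 0%MM.
    by move=> _; apply: leq_trans (mon_weight_le _ _) _; rewrite ?mdeg0.
  rewrite mdegD mdeg1 => h.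
  exact: leq_trans (mon_weight_addU q1 _ _) (HD _ h).
have dD (f : {mpoly k[m]}) : (mdegree f <= r)%N -> (mdegree (low_lift f) <= D)%N.
  by move=> /mdegree_leP H; apply: mdegree_low_lift => e /H /wD.
elim/fall_ind_var: g / => [f fF fr||f g hf hg IHf IHg|a f hf IH|i f hf fr IH].
- by apply: low_lift_gen => // e /(mdegree_leP _ _ fr); exact: wD.
- by rewrite /low_lift msupp0 big_nil; exact: fall_zero.
- have fr := fall_degree hf; have gr := fall_degree hg.
  apply: fall_values (fall_add IHf IHg) => //.
  + by apply: mdegreeD; exact: dD.
  + by apply/dD/mdegreeD.
  + by move=> y; rewrite mevalD !meval_low_lift mevalD.
- have fr := fall_degree hf.
  apply: fall_values (fall_scale a IH) => //.
  + by apply: leq_trans (mdegreeZ _ _) (dD _ _).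
  + by apply: dD; exact: leq_trans (mdegreeZ _ _) _.
  + by move=> y; rewrite mevalZ !meval_low_lift mevalZ.
- have d1 : (mdegree (low_lift f) <= D.-1)%N.
    apply: mdegree_low_lift => e /mdeg_mdegree ef.
    by have := HD e (leq_ltn_trans ef fr); lia.
  have hL := mdegree_Lform i 0.
  have d2 : (mdegree (Lform i 0 * low_lift f) <= D)%N.
    by apply: leq_trans (mdegreeM_le _ _) _; lia.
  apply: fall_values (fall_mul IH d2) => //.
  + apply: dD; apply: leq_trans (mdegreeM_le _ _) _.
    by rewrite mdegreeX mdeg1.
  + by move=> y; rewrite mevalM !meval_low_lift meval_Lform mevalM mevalXU expr1.
Qed.

(** Elements of the fall space over [k] have all coordinates in the fall space over [k'], since
    multiplication by a variable acts coordinatewise. Writing [1] as the sum of the [c j * alpha j],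
    the coordinates of [h] are the [c j *: h], and some [c j] is invertible. *)
Lemma weil_coord_descent d (h : {mpoly k'[m * n]}) :
  V d (map_mpoly iota h) -> fall_space (weil_system q F W) d h.
Proof.
pose T f := exists2 g : 'I_n -> {mpoly k'[m * n]},
  forall j, fall_space (weil_system q F W) d (g j) &
  f = \sum_(j < n) alpha j *: map_mpoly iota (g j).
have coord (a : k) : exists c : 'I_n -> k', a = \sum_(j < n) iota (c j) * alpha j.
  by have [c [hc _]] := halpha a; exists c.
have T0 : T 0.
  exists (fun=> 0); first by move=> j; exact: fall_zero.
  by rewrite big1 // => j _; rewrite raddf0 scaler0.
have TD f g : T f -> T g -> T (f + g).
  move=> [u hu ->] [w hw ->]; exists (fun j => u j + w j).
    by move=> j; exact: fall_add.
  by rewrite -big_split; apply: eq_bigr => j _ /=; rewrite raddfD scalerDr.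
have TZ a h0 : fall_space (weil_system q F W) d h0 -> T (a *: map_mpoly iota h0).
  move=> hh; have [c ->] := coord a; exists (fun j => c j *: h0).
    by move=> j; exact: fall_scale.
  rewrite scaler_suml; apply: eq_bigr => j _.
  by rewrite map_mpolyZ scalerA mulrC.
have TV f : V d f -> T f.
  elim/fall_ind_var: f / => [f||f g _ _|a f _|i f _ fd].
  - move=> /mapP[f0 f0W ->] fd; rewrite -[map_mpoly _ _]scale1r; apply: TZ.
    apply: fall_gen => //; apply: leq_trans fd.
    apply/mdegree_leP => e; rewrite mcoeff_msupp => nz; apply: mdeg_mdegree.
    by rewrite mcoeff_msupp mcoeff_map_mpoly fmorph_eq0.
  - exact: T0.
  - exact: TD.
  - move=> [u hu ->]; rewrite scaler_sumr.
    apply: (big_ind T) => // j _; rewrite scalerA; exact: TZ.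
  - move=> [u hu E]; exists (fun j => 'X_i * u j).
      move=> j; apply: (fall_mulW (a := 1) (b := d.-1)) => //.
      + by rewrite mdegreeX mdeg1.
      + have := mdegree_weil_coord u j; rewrite -E; lia.
      + by lia.
    rewrite E mulr_sumr; apply: eq_bigr => j _.
    by rewrite rmorphM /= map_mpolyX scalerAr.
move=> /TV[g hg E]; have [c hc] := coord 1.
have cE j : c j *: h = g j.
  apply/mpolyP => e; apply/eqP; rewrite -subr_eq0; apply/eqP; move: j.
  apply: basis_indep; under eq_bigr do rewrite rmorphB mulrBl /=.
  rewrite sumrB -(mcoeff_weil g) -E mcoeff_map_mpoly.
  apply/eqP; rewrite subr_eq0; apply/eqP.
  have Eh : iota h@_e = \sum_j iota (c j) * alpha j * iota h@_e.
    by rewrite -mulr_suml -hc mul1r.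
  apply: etrans _ (esym Eh).
  by apply: eq_bigr => j _; rewrite mcoeffZ rmorphM /= mulrAC.
have /existsP[j cj] : [exists j, c j != 0].
  rewrite -negb_forall; apply/negP => /forallP c0.
  have /eqP := hc; rewrite big1 ?oner_eq0 // => j _.
  by rewrite (eqP (c0 j)) rmorph0 mul0r.
by rewrite -(scale1r h) -(mulVf cj) -scalerA cE; apply: fall_scale.
Qed.

(** * Arithmetic modulo [f] within degree [D], and normal forms *)

Section NormalForms.
Variables (t : 'I_m) (f : {poly k}) (P : 'I_m -> {poly k}) (s0 D : nat).
Implicit Types (b c : {poly k}).
Hypothesis f_monic : f \is monic.
Hypothesis sf : size f = s0.+1.
Hypothesis s0_gt0 : (0 < s0)%N.
Hypothesis qD : (q <= D)%N.
Hypothesis pairD : forall i j, (i < s0)%N -> (j < s0)%N ->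
  (weight q i + weight q j <= D)%N.
Hypothesis succD : forall a, (a < 2 * s0 - 2)%N -> ((weight q a).+1 <= D)%N.

Definition uni (c : {poly k}) : S := \sum_(a < size c) c`_a *: Lpow t a.

Lemma meval_uni y c : (uni c).@[kpt y] = c.[weil_pt y t].
Proof.
rewrite raddf_sum /= horner_coef; apply: eq_bigr => a _.
by rewrite mevalZ meval_Lpow.
Qed.

Lemma mdegree_uni c d :
  (forall a, (a < size c)%N -> (weight q a <= d)%N) -> (mdegree (uni c) <= d)%N.
Proof.
move=> H; apply: mdegree_sum => a _.
by apply: leq_trans (mdegreeZ _ _) (leq_trans (mdegree_Lpow _ _) (H _ _)).
Qed.

(** A common degree bound for lifts of residues modulo [f] and, thanks to the [1], for linear forms;
    twice this bound is at most [D]. *)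
Definition uni_deg := maxn 1 (\max_(a < s0) weight q a).

Lemma uni_deg_double : (uni_deg + uni_deg <= D)%N.
Proof.
clear - q1 qD s0_gt0 pairD.
rewrite {1}/uni_deg; case: (leqP 1 (\max_(a < s0) weight q a)) => h; last first.
  by rewrite /uni_deg (maxn_idPl (ltnW h)); lia.
rewrite /uni_deg (maxn_idPr h).
have [|a ->] := @eq_bigmax _ (fun a : 'I_s0 => weight q a); last exact: pairD.
by rewrite card_ord.
Qed.

Lemma uni_deg_gt0 : (0 < uni_deg)%N.
Proof. by rewrite leq_max. Qed.

Lemma mdegree_uni_small c : (size c <= s0)%N -> (mdegree (uni c) <= uni_deg)%N.
Proof.
move=> sc; apply: mdegree_uni => a ac; rewrite leq_max; apply/orP; right.
exact: (leq_bigmax (Ordinal (leq_trans ac sc))).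
Qed.

(** The size [2 * s0 - 1] is that of a product of two residues. Its top exponent [2 * s0 - 2] is
    just beyond [succD], so the bound is applied to the preceding exponent. *)
Lemma mdegree_uni_double c : (size c <= 2 * s0 - 1)%N -> (mdegree (uni c) <= D)%N.
Proof.
move=> sc; apply: mdegree_uni => -[_|a ac]; first exact: leq0n.
by apply: leq_trans (weight_succ q1 _) (succD _); lia.
Qed.

Lemma size_modf c : (size (c %% f)%R <= s0)%N.
Proof. by rewrite -ltnS -sf ltn_modp monic_neq0. Qed.

Lemma modf_small c : (size c <= s0)%N -> c %% f = c.
Proof. by move=> sc; rewrite modp_small // sf. Qed.

Hypothesis Vf : V D (uni f).

(** The multiples are reached one factor [Lform t 0] at a time; before each step the exponents are
    below [2 * s0 - 2], so the degree is at most [D - 1]. *)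
Lemma uni_Xf j : (j.+1 < s0)%N -> V D (uni ('X^j * f)).
Proof.
elim: j => [|j IH] js; first by rewrite expr0 mul1r.
have f0 := monic_neq0 f_monic.
have sXf i : size ('X^i * f) = (s0.+1 + i)%N.
  by rewrite mulrC size_mulXn // sf addnC.
have d1 : (mdegree (uni ('X^j * f)) <= D.-1)%N.
  apply: mdegree_uni => a; rewrite sXf => ha.
  have /succD : (a < 2 * s0 - 2)%N by lia.
  lia.
have hL := mdegree_Lform t 0.
have d2 : (mdegree (Lform t 0 * uni ('X^j * f)) <= D)%N.
  by apply: leq_trans (mdegreeM_le _ _) _; lia.
apply: fall_values (fall_mul (IH (ltnW js)) d2) => //.
  by apply: mdegree_uni_double; rewrite sXf; lia.
move=> y; rewrite mevalM !meval_uni meval_Lform expr1 exprS -mulrA.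
by rewrite [RHS]hornerM hornerX.
Qed.

Lemma uni_mulf c : (size c < s0)%N -> V D (uni (c * f)).
Proof.
move=> sc; apply: (fall_values (h := \sum_(j < size c) c`_j *: uni ('X^j * f))) => //.
- apply: mdegree_sum => j _; apply: leq_trans (mdegreeZ _ _) _.
  apply: mdegree_uni_double; rewrite mulrC size_mulXn ?monic_neq0 // sf.
  by have := ltn_ord j; lia.
- apply: mdegree_uni_double; apply: leq_trans (size_polyMleq _ _) _; rewrite sf.
  by lia.
- move=> y; rewrite meval_uni hornerM horner_coef mulr_suml raddf_sum /=.
  by apply: eq_bigr => j _; rewrite mevalZ meval_uni hornerM hornerXn mulrA.
- apply: fall_sum => j _; apply/fall_scale/uni_Xf.
  exact: leq_ltn_trans (ltn_ord j) sc.
Qed.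

Lemma uni_modf c : (size c <= 2 * s0 - 1)%N -> V D (uni c - uni (c %% f)).
Proof.
move=> sc; have f0 := monic_neq0 f_monic.
have sm := size_modf c.
apply: fall_values (uni_mulf (c := c %/ f) _) => //.
- apply: mdegree_uni_double; apply: leq_trans (size_polyMleq _ _) _.
  by rewrite size_divp // sf; move: (size c) sc => x; lia.
- by apply: mdegreeB; apply: mdegree_uni_double => //; apply: leq_trans sm _; lia.
- move=> y; rewrite mevalB !meval_uni {2}(divp_eq c f) hornerD addrK.
  by [].
- by rewrite size_divp // sf; move: (size c) sc => x; lia.
Qed.

(** The product of the lifts and the lift of the product agree in value, within degree [D]; the
    latter is then reduced modulo [f]. *)
Lemma uni_mul b c : (size b <= s0)%N -> (size c <= s0)%N ->
  V D (uni b * uni c - uni ((b * c) %% f)).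
Proof.
move=> sb sc; have sbc : (size (b * c)%R <= 2 * s0 - 1)%N.
  by apply: leq_trans (size_polyMleq _ _) _; lia.
rewrite -(subrK (uni (b * c)) (uni b * uni c)) -addrA.
apply: fall_add; last exact: uni_modf.
apply: fall_values0 => //.
  apply: mdegreeB; last exact: mdegree_uni_double.
  apply: leq_trans (mdegreeM_le _ _) (leq_trans _ uni_deg_double).
  by apply: leq_add; exact: mdegree_uni_small.
by move=> y; rewrite mevalB mevalM !meval_uni hornerM subrr.
Qed.

Definition represents (l : S) (b : {poly k}) :=
  [/\ (mdegree l <= 1)%N, (size b <= s0)%N & V D (l - uni b)].

Lemma represents_mul l b c : represents l b -> (size c <= s0)%N ->
  V D (l * uni c - uni ((b * c) %% f)).
Proof.
move=> [dl sb Vl] sc; rewrite -(subrK (uni b * uni c) (l * uni c)) -addrA.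
apply: fall_add; last exact: uni_mul.
rewrite -mulrBl mulrC.
apply: (fall_mulW Vl _ _ uni_deg_double); first exact: mdegree_uni_small.
by apply: mdegreeB (mdegree_uni_small sb); apply: leq_trans dl uni_deg_gt0.
Qed.

(** One factor [l] is multiplied in at a time, with reduction modulo [f] after each; [a <= q <= D]
    keeps the powers of [l] within degree [D]. *)
Lemma represents_exp l b a : represents l b -> (a <= q)%N ->
  V D (l ^+ a - uni (b ^+ a %% f)).
Proof.
move=> hl; have [dl sb Vl] := hl; have dd := uni_deg_double; have d0 := uni_deg_gt0.
elim: a => [|a IH] aq.
  rewrite !expr0 modf_small ?size_poly1 //; apply: fall_values0 => //.
    apply: mdegreeB; first by rewrite mdegreeC.
    by apply: leq_trans (mdegree_uni_small _) _; rewrite ?size_poly1 //; lia.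
  by move=> y; rewrite mevalB meval1 meval_uni hornerC subrr.
have -> : l ^+ a.+1 - uni (b ^+ a.+1 %% f) =
    l * (l ^+ a - uni (b ^+ a %% f)) +
    (l * uni (b ^+ a %% f) - uni ((b * (b ^+ a %% f)) %% f)).
  by rewrite modp_mul -!exprS mulrBr -exprS addrA subrK.
apply: fall_add; last by apply: represents_mul => //; exact: size_modf.
apply: (fall_mulW (b := D.-1) (IH (ltnW aq)) dl); last by lia.
apply: mdegreeB.
  by apply: leq_trans (mdegree_exp _ _) _; nia.
by apply: leq_trans (mdegree_uni_small (size_modf _)) _; lia.
Qed.

(** At rational points [Lform i j.+1] has the values of [Lform i j ^+ q], so each conjugation costs
    only degree [q]. *)
Lemma represents_frob i b j : represents (Lform i 0) b ->
  represents (Lform i j) (b ^+ (q ^ j) %% f).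
Proof.
move=> hb; elim: j => [|j IH].
  by have [? sb ?] := hb; rewrite expr1 modf_small.
split; [exact: mdegree_Lform|exact: size_modf|].
have := represents_exp IH (leqnn q).
have -> : (b ^+ (q ^ j) %% f) ^+ q %% f = b ^+ (q ^ j.+1) %% f.
  by rewrite expnSr exprM modp_expl.
have du : (mdegree (uni (b ^+ (q ^ j.+1) %% f)%R) <= D)%N.
  apply: leq_trans (mdegree_uni_small (size_modf _)) _.
  by have := uni_deg_double; lia.
apply: fall_values => //.
- apply: mdegreeB => //; apply: leq_trans (mdegree_exp _ _) _.
  by have := mdegree_Lform i j; nia.
- by apply: mdegreeB => //; apply: leq_trans (mdegree_Lform _ _) _; lia.
- by move=> y; rewrite !mevalB rmorphXn /= !meval_Lform -exprM -expnSr.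
Qed.

Lemma size_lin (I : Type) (r : seq I) (a : I -> k) (c : I -> {poly k}) :
  (forall i, size (c i) <= s0)%N -> (size (\sum_(i <- r) a i *: c i)%R <= s0)%N.
Proof.
move=> sc; apply: (big_ind (fun p : {poly k} => size p <= s0)%N) => [|x y sx sy|i _].
- by rewrite size_poly0.
- by rewrite (leq_trans (size_polyD _ _)) // geq_max sx.
- exact: leq_trans (size_scale_leq _ _) (sc i).
Qed.

Lemma uni_lin (I : Type) (r : seq I) (a : I -> k) (c : I -> {poly k}) d :
  (D <= d)%N -> (forall i, size (c i) <= s0)%N ->
  V d (\sum_(i <- r) a i *: uni (c i) - uni (\sum_(i <- r) a i *: c i)).
Proof.
move=> Dd sc; have dd := uni_deg_double.
apply: (fall_leq (d := D) (H := ext_system)) => //.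
apply: fall_values0 => //.
  apply: mdegreeB.
    apply: mdegree_sum => i _; apply: leq_trans (mdegreeZ _ _) _.
    by apply: leq_trans (mdegree_uni_small (sc i)) _; lia.
  apply: (@leq_trans uni_deg); last lia.
  by apply: mdegree_uni_small; exact: size_lin.
move=> y; rewrite mevalB meval_uni horner_sum raddf_sum /=.
rewrite -sumrB big1 // => i _.
by rewrite mevalZ meval_uni hornerZ subrr.
Qed.

Hypothesis hk : #|k| = (q ^ n)%N.
Hypothesis hP : forall i, represents (Lform i 0) (P i).

(** The Moore matrix of the basis is invertible, so each variable is a [k]-linear combination of the
    conjugate forms. *)
Lemma represents_X x : exists b, represents 'X_x b.
Proof.
case/mxvec_indexP: x => i l.
pose M : 'M[k]_n := \matrix_(j, l) alpha l ^+ (q ^ j).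
have Munit : M \in unitmx.
  rewrite -row_free_unit; apply: inj_row_free => v vM.
  (* A left kernel vector gives a linearized polynomial that vanishes on the basis, hence on all
     [q ^ n] elements of [k], although its degree is smaller. *)
  pose p : {poly k} := \sum_j v 0 j *: 'X^(q ^ j).
  have pE x : p.[x] = \sum_j v 0 j * x ^+ (q ^ j).
    by rewrite horner_sum; apply: eq_bigr => j _; rewrite hornerZ hornerXn.
  have p0 x : p.[x] = 0.
    have [c [-> _]] := halpha x; rewrite pE.
    have E j : (\sum_l iota (c l) * alpha l) ^+ (q ^ j) =
        \sum_l iota (c l) * alpha l ^+ (q ^ j).
      have hqj : [pchar k].-nat (q ^ j)%N by rewrite pnatX hq.
      rewrite -[LHS]/(frob_pow hqj _) rmorph_sum /=; apply: eq_bigr => l' _.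
      by rewrite /frob_pow exprMn iota_frob.
    under eq_bigr do rewrite E mulr_sumr.
    rewrite exchange_big big1 //= => l' _.
    under eq_bigr do rewrite mulrCA.
    rewrite -mulr_sumr; have /matrixP/(_ 0 l') := vM.
    by rewrite !mxE; under eq_bigr do rewrite mxE; move=> ->; rewrite mulr0.
  have pz : p = 0.
    apply/eqP; apply: contraT => pn0.
    have := max_poly_roots pn0 (rs := enum k) _ (enum_uniq _).
    have -> : all (root p) (enum k) by apply/allP => x _; apply/rootP.
    move=> /(_ isT); rewrite -cardE hk ltnNge => /negP[].
    apply: leq_trans (size_sum _ _ _) _; apply/bigmax_leqP => j _.
    apply: leq_trans (size_scale_leq _ _) _; rewrite size_polyXn.
    by rewrite ltn_exp2l.
  apply/rowP => j; rewrite mxE.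
  have := congr1 (fun p : {poly k} => p`_(q ^ j)) pz.
  rewrite coef0 coef_sum (bigD1 j) //= coefZ coefXn eqxx mulr1 big1 ?addr0 //.
  move=> i' ne; rewrite coefZ coefXn eqn_exp2l // [_ == _ :> nat]eq_sym.
  by rewrite val_eqE (negPf ne) mulr0.
pose b (j : 'I_n) := P i ^+ (q ^ j) %% f.
exists (\sum_j invmx M l j *: b j).
have inv l' : \sum_j invmx M l j * alpha l' ^+ (q ^ j) = (l == l')%:R.
  have /matrixP/(_ l l') := mulVmx Munit; rewrite !mxE => <-.
  by apply: eq_bigr => j _; rewrite [M j l']mxE.
have -> : 'X_(idx i l) = \sum_j invmx M l j *: Lform i j.
  transitivity (\sum_l' (l == l')%:R *: 'X_(idx i l') : S).
    rewrite (bigD1 l) //= eqxx scale1r big1 ?addr0 // => l' ne.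
    by rewrite eq_sym (negPf ne) scale0r.
  under [RHS]eq_bigr do rewrite scaler_sumr.
  rewrite exchange_big; apply: eq_bigr => l' _.
  by rewrite -inv scaler_suml; apply: eq_bigr => j _; rewrite scalerA.
have sb j : (size (b j) <= s0)%N by exact: size_modf.
split.
- apply: mdegree_sum => j _; apply: leq_trans (mdegreeZ _ _) _.
  exact: mdegree_Lform.
- exact: size_lin.
- rewrite -(subrK (\sum_(j < n) invmx M l j *: uni (b j))
    (\sum_(j < n) _ *: Lform i j)) -addrA.
  apply: fall_add; last exact: uni_lin.
  rewrite -sumrB; apply: fall_sum => j _; rewrite -scalerBr; apply: fall_scale.
  by have [] := represents_frob j (hP i).
Qed.

Lemma normal_form (h : S) : exists2 c : {poly k}, (size c <= s0)%N &
  V (maxn D (mdegree h)) (h - uni c).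
Proof.
have dd := uni_deg_double; have d0 := uni_deg_gt0.
have mono N e : (mdeg e < N)%N -> exists2 c : {poly k}, (size c <= s0)%N &
    V (maxn D (mdeg e)) ('X_[e] - uni c).
  elim: N e => // N IH e eN.
  have [->|/mnm_neq0_split[x Ee]] := eqVneq e 0%MM.
    exists 1; rewrite ?size_poly1 // mpolyX0 mdeg0 maxn0; apply: fall_values0 => //.
      apply: mdegreeB; first by rewrite mdegreeC.
      by apply: leq_trans (mdegree_uni_small _) _; rewrite ?size_poly1 //; lia.
    by move=> y; rewrite mevalB meval1 meval_uni hornerC subrr.
  have de : mdeg e = (mdeg (e - U_(x))%MM).+1 by rewrite {1}Ee mdegD mdeg1.
  have [|c sc Vc] := IH (e - U_(x))%MM; first by lia.
  have [b hb] := represents_X x; have [dX sb _] := hb.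
  exists ((b * c) %% f); first exact: size_modf.
  have -> : 'X_[e] - uni ((b * c) %% f) = 'X_x * ('X_[e - U_(x)] - uni c) +
      ('X_x * uni c - uni ((b * c) %% f)).
    by rewrite mulrBr addrA subrK -mpolyXD -Ee.
  apply: fall_add.
    (* The degree of [uni c] is at most [uni_deg], hence at most [D - 1], which leaves room for the
       variable. *)
    apply: (fall_mulW (a := 1) (b := maxn D.-1 (mdeg (e - U_(x))%MM))) => //.
    - by apply: fall_leq Vc => //; rewrite de; lia.
    - apply: mdegreeB; first by rewrite mdegreeX leq_maxr.
      by apply: leq_trans (mdegree_uni_small sc) _; lia.
    - by rewrite de; lia.
  apply: fall_leq (represents_mul hb sc) => //.
  by rewrite leq_maxl.
suff gen (r : seq 'X_{1..m * n}) : {subset r <= msupp h} -> exists2 c : {poly k},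
    (size c <= s0)%N &
    V (maxn D (mdegree h)) (\sum_(e <- r) h@_e *: 'X_[e] - uni c).
  by have [|c] := gen (msupp h); rewrite -?mpolyE //; exists c.
elim: r => [|e r IH] hr.
  exists 0; rewrite ?size_poly0 // big_nil sub0r; apply: fallN.
  by rewrite /uni size_poly0 big_ord0; exact: fall_zero.
have [|c1 sc1 Vc1] := IH; first by move=> y yr; rewrite hr // inE yr orbT.
have [c2 sc2 Vc2] := mono _ e (ltnSn _).
exists (h@_e *: c2 + c1).
  rewrite (leq_trans (size_polyD _ _)) // geq_max sc1 andbT.
  by rewrite (leq_trans (size_scale_leq _ _)).
have ef : (mdeg e <= mdegree h)%N by rewrite mdeg_mdegree ?hr ?mem_head.
rewrite big_cons.
have -> : h@_e *: 'X_[e] + \sum_(e <- r) h@_e *: 'X_[e] - uni (h@_e *: c2 + c1) =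
   (h@_e *: ('X_[e] - uni c2) + (\sum_(e <- r) h@_e *: 'X_[e] - uni c1)) +
   (h@_e *: uni c2 + uni c1 - uni (h@_e *: c2 + c1)).
  by rewrite scalerBr [X in _ = X + _]addrACA -opprD addrA subrK.
apply: fall_add; first apply: fall_add => //.
  by apply: fall_scale; apply: fall_leq Vc2 => //; lia.
apply: (fall_leq (d := D) (H := ext_system)) => //; first exact: leq_maxl.
apply: fall_values0 => //.
  apply: (@leq_trans uni_deg); last lia.
  have d1 := mdegree_uni_small sc1; have d2 := mdegree_uni_small sc2.
  apply: mdegreeB; first apply: mdegreeD => //.
    exact: leq_trans (mdegreeZ _ _) d2.
  apply: mdegree_uni_small; rewrite (leq_trans (size_polyD _ _)) // geq_max sc1 andbT.
  by rewrite (leq_trans (size_scale_leq _ _)).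
move=> y; rewrite mevalB mevalD mevalZ !meval_uni !hornerE.
by rewrite subrr.
Qed.

Hypothesis ft : f %| 'X - P t.

(* c * (1 - f^(|k|-1)) vanishes on k, which puts c in the ideal (f, X^|k| - X). *)
Lemma uni_rational0 c : (size c <= s0)%N ->
  (forall rho, root f rho -> c.[rho] = 0) -> V D (uni c).
Proof.
move=> sc c0; have [dL sP VP] := hP t; have dd := uni_deg_double.
(* [U] is the residue of ['X^#|k| - 'X] modulo [f]. Its lift is in [V D] because [Lform t n] and
   [Lform t 0] have equal values. *)
pose U := P t ^+ (q ^ n) %% f - P t.
have sU : (size U <= s0)%N.
  by rewrite (leq_trans (size_polyD _ _)) // geq_max size_polyN sP size_modf.
have VU : V D (uni U).
  have [_ sPn VPn] := represents_frob n (hP t).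
  apply: fall_values (fallB VP VPn) => //.
  - apply: (@leq_trans uni_deg); last lia.
    apply: mdegreeB; apply: mdegreeB; rewrite ?mdegree_uni_small //.
      by rewrite (leq_trans dL) // uni_deg_gt0.
    by rewrite (leq_trans (mdegree_Lform _ _)) // uni_deg_gt0.
  - by apply: leq_trans (mdegree_uni_small sU) _; lia.
  - move=> y; rewrite !mevalB !meval_Lform !meval_uni hornerD hornerN.
    by rewrite expn0 expr1 -hk expf_card opprB addrC addrA subrK.
have Xt : 'X %% f = P t.
  by apply/eqP; rewrite -(modf_small sP) -subr_eq0 -modpN -modpD; exact: ft.
have EU : ('X^#|k| - 'X) %% f = U.
  by rewrite modpD modpN Xt hk -modp_expl Xt.
pose G := c * (1 - f ^+ #|k|.-1).
have [v Ev] : exists v, G = v * ('X^#|k| - 'X).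
  exists (G %/ ('X^#|k| - 'X)); rewrite divpK // finField_genPoly -big_enum.
  apply: uniq_roots_dvdp; last by rewrite uniq_rootsE enum_uniq.
  apply/allP => x _; rewrite /root /G hornerM.
  have [/c0->|fx] := boolP (root f x); first by rewrite mul0r.
  rewrite !hornerE; have -> : f.[x] ^+ #|k|.-1 = 1.
    by apply: (mulfI fx); rewrite mulr1 -exprS prednK ?expf_card // ltnW ?finNzRing_gt1.
  by rewrite subrr mulr0.
have Ec : c = ((v %% f) * U) %% f.
  rewrite -EU modp_mul mulrC modp_mul mulrC -Ev /G mulrBr mulr1.
  rewrite modpD modpN (modf_small sc).
  have -> : #|k|.-1 = #|k|.-2.+1 by rewrite prednK // -subn1 subn_gt0 finNzRing_gt1.
  by rewrite exprSr mulrA modp_mull subr0.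
rewrite Ec -(subrK (uni (v %% f) * uni U) (uni _)).
apply: fall_add.
  by rewrite -opprB; apply: fallN; apply: uni_mul => //; exact: size_modf.
apply: (fall_mulW VU _ _ dd); apply: mdegree_uni_small => //.
exact: size_modf.
Qed.

Lemma weil_pt_surj (z : 'I_m -> k) : exists y, weil_pt y =1 z.
Proof.
have [c hc] := fin_all_exists (fun i => halpha (z i)).
have [g gK Kg] := curry_mxvec_bij m n.
exists (fun x => c (g x).1 (g x).2) => i; rewrite (hc i).1.
apply: eq_bigr => l _; rewrite mulrC.
by have /= -> := gK (i, l).
Qed.

Lemma weil_system_meval y : (forall g, g \in F -> g.@[weil_pt y] = 0) ->
  forall g, g \in weil_system q F W -> g.@[y] = 0.
Proof.
move=> hy g; rewrite mem_cat => /orP[/allpairsP[[h j] /= [hF _ ->]]|]; last first.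
  move=> /allpairsP[[i l] [_ _ ->]] /=; rewrite /Xvar mevalB rmorphXn /= mevalXU.
  by rewrite -hk' expf_card subrr.
have [hid _] := hW hF.
have := in_ideal_meval (fun g => @field_eqs_meval g y) hid.
rewrite mevalB comp_mpoly_meval.
have -> : h.@[fun i =>
    (tnth [tuple \sum_(l < n) alpha l *: Xvar k i l | i < m] i).@[kpt y]] = h.@[weil_pt y].
  apply: meval_eq => i; rewrite tnth_mktuple raddf_sum /=.
  by apply: eq_bigr => l _; rewrite mevalZ mevalXU.
rewrite hy // sub0r => /eqP; rewrite oppr_eq0 raddf_sum /=.
under eq_bigr do rewrite mevalZ -meval_rmorph mulrC.
by move=> /eqP/basis_indep/(_ j).
Qed.

(** A root [rho] of [f] in [k] gives a zero of [F] in [k^m], hence a [k']-rational zero [y] of the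
    Weil system. There [h] vanishes, so its normal form [c] vanishes at [rho], and [uni_rational0]
    applies. *)
Lemma weil_fall_bound :
  (forall rho, root f rho -> forall g, g \in F -> g.@[fun i => (P i).[rho]] = 0) ->
  fall_bound (weil_system q F W) (Some D).
Proof.
move=> hz h hh /=; apply: weil_coord_descent.
have dh := mdegree_map iota h.
have [c sc Vc] := normal_form (map_mpoly iota h).
have {}Vc : V (maxn D (mdegree h)) (map_mpoly iota h - uni c).
  apply: fall_leq Vc => //.
  by rewrite geq_max leq_maxl (leq_trans dh) ?leq_maxr.
rewrite -(subrK (uni c) (map_mpoly iota h)); apply: fall_add => //.
apply: (fall_leq (d := D) (H := ext_system)) => //; first exact: leq_maxl.
apply: uni_rational0 => // rho hrho.
have [y hy] := weil_pt_surj (fun i => (P i).[rho]).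
have y0 : forall g, g \in weil_system q F W -> g.@[y] = 0.
  apply: weil_system_meval => g gF; rewrite (meval_eq _ hy); exact: hz.
have : (map_mpoly iota h - uni c).@[kpt y] = 0.
  apply: fall_meval Vc => _ /mapP[g gW ->].
  by rewrite -meval_rmorph y0 // rmorph0.
rewrite mevalB -meval_rmorph (in_ideal_meval y0 hh) rmorph0 sub0r meval_uni hy.
have -> : (P t).[rho] = rho.
  have /dvdpP[w Ew] := ft; have := congr1 (fun p => p.[rho]) Ew.
  rewrite hornerM (rootP hrho) mulr0 !hornerE => /eqP.
  by rewrite subr_eq0 => /eqP.
by move/eqP; rewrite oppr_eq0 => /eqP.
Qed.

End NormalForms.

(** * Transfer of the shape lemma, and the final bound *)

Lemma mdegree_horner_alg (t : 'I_m) (c : {poly k}) d : (size c <= d.+1)%N ->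
  (mdegree (horner_alg ('X_t : {mpoly k[m]}) c) <= d)%N.
Proof.
move=> sc; rewrite -[c]coefK poly_def raddf_sum /=; apply: mdegree_sum => a _.
rewrite linearZ rmorphXn /= horner_algX -scalerAl mul1r.
apply: leq_trans (mdegreeZ _ _) (leq_trans (mdegree_exp _ _) _).
by rewrite mdegreeX mdeg1 mul1n -ltnS (leq_trans (ltn_ord a)).
Qed.

(** Since [r] bounds a fall degree of [F] and the degrees of [f(X_t)] and [X_i - P_i(X_t)], these
    polynomials lie in the fall space of index [r]. Their lifts provide the starting congruences for
    the normal forms. *)
Lemma weil_fall_bound_shape (t : 'I_m) (f : {poly k}) (P : 'I_m -> {poly k})
    (s0 d r D : nat) :
  #|k| = (q ^ n)%N -> f \is monic -> size f = s0.+1 -> (0 < s0)%N ->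
  in_ideal F (horner_alg 'X_t f) ->
  (forall i, size (P i) <= s0)%N ->
  (forall i, in_ideal F ('X_i - horner_alg 'X_t (P i))) ->
  f %| 'X - P t ->
  (forall rho, root f rho -> forall g, g \in F -> g.@[fun i => (P i).[rho]] = 0) ->
  fall_bound F (Some d) -> (d <= r)%N -> (s0 <= r)%N ->
  (q <= D)%N ->
  (forall e : 'X_{1..m}, (mdeg e < r)%N -> ((mon_weight q e).+1 <= D)%N) ->
  (forall i j, (i < s0)%N -> (j < s0)%N -> (weight q i + weight q j <= D)%N) ->
  (forall i, (i < 2 * s0 - 2)%N -> ((weight q i).+1 <= D)%N) ->
  fall_bound (weil_system q F W) (Some D).
Proof.
move=> hk fm sf s0_gt0 If sP IP ft hz hd dr s0r qD wD pairD succD.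
have lift g : in_ideal F g -> (mdegree g <= r)%N -> V D (low_lift g).
  move=> Ig gr; apply: (low_lift_fall (r := r)) => //.
  by apply: fall_leq (hd g Ig) => //=; rewrite geq_max dr.
have Vf : V D (uni t f).
  have df : (mdegree (horner_alg ('X_t : {mpoly k[m]}) f) <= r)%N.
    by apply: mdegree_horner_alg; rewrite sf ltnS.
  have Vl := lift _ If df; apply: fall_values (Vl) => //.
  - exact: fall_degree Vl.
  - apply: mdegree_uni => -[_|a]; first exact: leq0n.
    rewrite sf ltnS => ha; apply: leq_trans (weight_succ q1 _) _.
    by have := pairD a a ha ha; lia.
  - by move=> y; rewrite meval_low_lift meval_horner_alg meval_uni.
apply: (weil_fall_bound fm sf s0_gt0 qD pairD succD Vf hk _ ft hz) => i.
have dd := uni_deg_double s0_gt0 qD pairD.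
have dP := mdegree_uni_small t (sP i).
split=> //; first exact: mdegree_Lform.
have di : (mdegree ('X_i - horner_alg 'X_t (P i) : {mpoly k[m]}) <= r)%N.
  apply: mdegreeB; first by rewrite mdegreeX mdeg1; lia.
  by apply: mdegree_horner_alg; apply: leq_trans (sP i) _; lia.
have Vl := lift _ (IP i) di; apply: fall_values (Vl) => //.
- exact: fall_degree Vl.
- apply: mdegreeB; last by lia.
  by apply: leq_trans (mdegree_Lform _ _) _; lia.
- move=> y; rewrite meval_low_lift !mevalB mevalXU meval_horner_alg meval_uni.
  by rewrite meval_Lform expr1.
Qed.

End Weil.

Theorem theorem1p1
    (q n m : nat)
    (hq : exists p e : nat, [/\ prime p, (0 < e)%N & q = (p ^ e)%N])
    (hn : (1 <= n)%N) (hm : (1 <= m)%N)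
    (k : finFieldType) (hk : #|k| = (q ^ n)%N)
    (F : seq {mpoly k[m]})
    (* an algebraic closure of k *)
    (kbar : closedFieldType) (phi : {rmorphism k -> kbar})
    (hphi : integralRange phi)
    (hdim : zero_dimensional F)
    (s : nat)
    (hs : exists Z : seq (m.-tuple kbar),
        (size Z <= s)%N /\ forall z, zero_locus phi F z -> z \in Z)
    (hrad : radical_ideal F)
    (hproj : exists t : 'I_m, forall z1 z2 : m.-tuple kbar,
        zero_locus phi F z1 -> zero_locus phi F z2 ->
        tnth z1 t = tnth z2 t -> z1 = z2)
    (* the subfield of k of cardinality q is the image of k' under iota *)
    (k' : finFieldType) (hk' : #|k'| = q) (iota : {rmorphism k' -> k})
    (alpha : 'I_n -> k) (halpha : is_basis iota alpha)
    (W : {mpoly k[m]} -> 'I_n -> {mpoly k'[m * n]})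
    (hW : forall f, f \in F -> is_weil_descent iota q alpha f (W f))
    (dF dW : enat)
    (hdF : last_fall_degree F dF)
    (hdW : last_fall_degree (weil_system q F W) dW) :
  ele dW
    (emax
       (etau (emax dF (Some (maxn (sys_degree F) (maxn (m.+1 * s) 1)))) q m)
       (Some (maxn (m * tau (2 * s) q 1) q))).
Proof.
case: dF hdF => [d|] [hF _]; last by case: dW {hdW}.
rewrite [X in ele _ X]/=; set r := maxn d _; set D := maxn (tau r q m) _.
(* By minimality of [dW], it is enough that [D] is a fall bound for the Weil system. *)
apply: hdW.2.
have [p [e [pp e0 Eq]]] := hq.
have q1 : (1 < q)%N by rewrite Eq -(exp1n e) ltn_exp2r // prime_gt1.
have pk : p \in [pchar k].
  by apply: (card_finPcharP (n := (e * n)%N)) => //; rewrite hk Eq expnM.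
have hqn : [pchar k].-nat q by rewrite Eq pnatX pnatE // pk.
have hQ : [pchar k].-nat #|k| by rewrite hk pnatX hqn.
have [t [f [P [s0 [[fm sf /andP[s00 s0s] If] [sP IP ft hz]]]]]] :=
  shape_lemma hdim hrad hQ hs hproj.
have tD : (tau (2 * s) q 1 <= D)%N.
  by rewrite !leq_max; apply/orP; right; rewrite leq_pmull.
apply: (weil_fall_bound_shape q1 hqn hk' halpha hW (t := t) (f := f) (P := P)
  (s0 := s0) (d := d) (r := r)) => //.
- exact: leq_maxl.
- rewrite !leq_max; apply/orP; right; apply/orP; right; apply/orP; left.
  by apply: leq_trans s0s _; rewrite leq_pmull.
- by rewrite !leq_max leqnn !orbT.
- move=> u ur; have sgt0 : (0 < s)%N by exact: leq_trans s00 s0s.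
  apply: leq_trans (mon_weight_bound q1 hm sgt0 ur) _.
  by rewrite geq_max !leq_max leqnn /= leqnn !orbT.
- move=> i j hi hj; apply: leq_trans tD.
  by apply: weight_pair_bound => //; exact: leq_trans s0s.
- move=> i hi; apply: leq_trans tD; apply: weight_succ_bound => //.
  by lia.
Qed.
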